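(* Fix a real number $\beta>-1$ and let $\phi$ be an analytic self-map of $\mathbb{D}$. If the composition operator $C_\phi:A^2_\beta\to A^2_\beta$, $C_\phi f=f\circ\phi$, is complex symmetric, then $\phi$ is either an elliptic automorphism of $\mathbb{D}$ or has its Denjoy–Wolff point in $\mathbb{D}$ (in particular, $\phi$ fixes a point of $\mathbb{D}$).
   Context: $\mathbb{D}$ is the open unit disc. For $\beta>-1$, $A^2_\beta$ is the Hilbert space of analytic functions $f(z)=\sum_{n\ge0}\widehat f(n)z^n$ on $\mathbb{D}$ with inner product $\langle f,g\rangle=\sum_{n\ge0}\frac{n!\,\Gamma(2+\beta)}{\Gamma(n+2+\beta)}\widehat f(n)\overline{\widehat g(n)}$ (equivalently the $L^2$ inner product with respect to $(\beta+1)(1-|z|^2)^\beta dA(z)$). A conjugation on a Hilbert space $\mathcal H$ is a conjugate-linear map $C$ with $C^2=I$ and $\langle Cf,Cg\rangle=\langle g,f\rangle$ for all $f,g$; a bounded operator $T$ is complex symmetric if $CT=T^*C$ for some conjugation $C$. An elliptic automorphism is an automorphism of $\mathbb{D}$ with a fixed point in $\mathbb{D}$. If $\phi$ is not an elliptic automorphism, there is a unique $\omega\in\overline{\mathbb{D}}$ with $\phi^{[n]}(z)\to\omega$ for all $z\in\mathbb{D}$ ($\phi^{[n]}$ the $n$-th iterate), the Denjoy–Wolff point of $\phi$. *)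

(* Defs.v *)
From Stdlib Require Import Reals ClassicalEpsilon.
From Coquelicot Require Import Coquelicot.

Open Scope R_scope.

Definition inD (z : C) : Prop := Cmod z < 1.

Definition holo_on_D (f : C -> C) : Prop :=
  forall z : C, inD z -> exists l : C, is_derive (K := C_AbsRing) (V := C_NormedModule) f z l.

Definition self_map (phi : C -> C) : Prop :=
  holo_on_D phi /\ forall z : C, inD z -> inD (phi z).

(* Weight  n! Gamma(2+beta) / Gamma(n+2+beta) = prod_{k<n} (k+1)/(k+2+beta). *)
Fixpoint wt (beta : R) (n : nat) : R :=
  match n with
  | O => 1
  | S m => wt beta m * ((INR m + 1) / (INR m + 2 + beta))
  end.

Definition is_coef (a : nat -> C) (f : C -> C) : Prop :=
  forall z : C, inD z -> is_series (fun n => (a n * Cpow z n)%C) (f z).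

Definition in_A2 (beta : R) (f : C -> C) : Prop :=
  exists a : nat -> C, is_coef a f /\
    ex_series (fun n => wt beta n * (Cmod (a n))^2).

Definition A2_ip_is (beta : R) (f g : C -> C) (v : C) : Prop :=
  exists a b : nat -> C, is_coef a f /\ is_coef b g /\
    is_series (fun n => (RtoC (wt beta n) * a n * Cconj (b n))%C) v.

(* The inner product (well defined on A^2_beta by uniqueness of coefficients;
   arbitrary outside). *)
Definition A2_ip (beta : R) (f g : C -> C) : C :=
  epsilon (inhabits (RtoC 0)) (A2_ip_is beta f g).

(* Conjugation on A^2_beta (elements are functions, identified when equal on D). *)
Definition is_conjugation (beta : R) (J : (C -> C) -> (C -> C)) : Prop :=
  (forall f, in_A2 beta f -> in_A2 beta (J f)) /\
  (forall f g (lam : C), in_A2 beta f -> in_A2 beta g ->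
     forall z, inD z ->
       J (fun w => (f w + lam * g w)%C) z = (J f z + Cconj lam * J g z)%C) /\
  (forall f, in_A2 beta f -> forall z, inD z -> J (J f) z = f z) /\
  (forall f g, in_A2 beta f -> in_A2 beta g ->
     A2_ip beta (J f) (J g) = A2_ip beta g f).

Definition comp_bounded (beta : R) (phi : C -> C) : Prop :=
  (forall f, in_A2 beta f -> in_A2 beta (fun z => f (phi z))) /\
  exists M : R, forall f, in_A2 beta f ->
    fst (A2_ip beta (fun z => f (phi z)) (fun z => f (phi z)))
      <= M * fst (A2_ip beta f f).

(* C_phi is complex symmetric: J C_phi = C_phi^* J for a conjugation J,
   i.e. <J (f o phi), g> = <J f, g o phi> for all f, g. *)
Definition comp_complex_symmetric (beta : R) (phi : C -> C) : Prop :=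
  exists J, is_conjugation beta J /\
    forall f g, in_A2 beta f -> in_A2 beta g ->
      A2_ip beta (J (fun z => f (phi z))) g = A2_ip beta (J f) (fun z => g (phi z)).

Definition disc_aut (phi : C -> C) : Prop :=
  self_map phi /\ exists psi, self_map psi /\
    forall z, inD z -> psi (phi z) = z /\ phi (psi z) = z.

Definition elliptic_aut (phi : C -> C) : Prop :=
  disc_aut phi /\ exists z, inD z /\ phi z = z.

Definition iterates_converge_to (phi : C -> C) (omega : C) : Prop :=
  forall z, inD z ->
    filterlim (fun n : nat => Nat.iter n phi z) eventually (locally omega).

(* Main.v *)
Require Import Defs.
From Stdlib Require Import Reals Lra Lia FunctionalExtensionality Classical ClassicalEpsilon.
From Coquelicot Require Import Coquelicot.

(** If [J] is the conjugation, [G = J 1] is a unit vector fixed by the adjoint of the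
    composition operator, so [<z^m, G> = <(phi^[n])^m, G>] for all [m] and [n].  When
    [|phi^[n](0)|] comes close to [1], the function [(phi^[n])^m], being bounded by [1],
    is close in norm to its value at [0]; hence if the orbit of [0] accumulates at the
    circle, [|<z^m, G>| = |G(0)|] for all [m], so that the coefficients of [G] are too
    large for [A^2_beta].  Thus the orbit of [0] stays in a compact subset of the disc.
    As [phi] is nonexpansive for the hyperbolic distance, the asymptotic centre of this
    orbit is a fixed point [p].  At [p], the Schwarz lemma leaves a rotation around [p]
    or geometric convergence to [p].

    [phi] is the composition with [phi] of the function [z], hence lies in [A^2_beta]
    and is given by a power series: no Cauchy theory is needed.  Schwarz-Pick estimates
    at two points and around [p] are read off the positivity of the Pick kernel
    [(1 - conj (phi x) phi y) / (1 - conj x y)], proved by averaging over [N]-th roots of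
    unity and letting [N] tend to infinity. *)

(** * Finite sums and limits in [C] *)

(** [G] is fixed by the adjoint because the constant [1] is fixed by composition and [J] intertwines
    the operator with its adjoint. A function [h] bounded by [1] with [|h(0)|] near [1] is nearly
    constant because its Hardy norm is at most [1]: the squared moduli of its coefficients sum to at
    most [1], and the constant term takes almost all of it. The weights are at most [1], so this
    Hardy bound controls the weighted norm; they also give [|g m| >= |g 0|] once
    [wt m * |g m| = |g 0|]. The terms of the norm of [G] are then at least [|g 0|^2], so [g 0 = 0]
    and [G = 0], against [|G| = 1].

    The averages replace integrals over the circle: Parseval is exact for polynomials of degree
    below [N], and the reproducing property of the Szego kernel holds up to an error that vanishes
    with [N]. Since [f] need not extend to the circle, estimates there are made for partial sums of
    [f (r * z)] with [r < 1]; then their length tends to infinity, and [r] to [1]. *)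

Lemma Re_plus (a b : C) : Re (a + b) = Re a + Re b.
Proof. reflexivity. Qed.

Lemma Re_scal (r : R) (a : C) : Re (r * a) = r * Re a.
Proof. unfold Re; simpl; ring. Qed.

Lemma Cconj_1 : Cconj 1 = 1.
Proof. apply injective_projections; simpl; ring. Qed.

(** The upper bound is excluded, so sums over [N] roots or [n] points need no shift; [sum_n]
    includes its last index, whence the [S n] in conversions. *)
Fixpoint csum (u : nat -> C) (n : nat) : C :=
  match n with
  | O => 0
  | S m => (csum u m + u m)%C
  end.

Lemma csum_ext (u v : nat -> C) (n : nat) :
  (forall i, (i < n)%nat -> u i = v i) -> csum u n = csum v n.
Proof.
  induction n as [|n IH]; intros H; simpl; [reflexivity|].
  rewrite IH, H; auto.
Qed.

Lemma csum_plus (u v : nat -> C) (n : nat) :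
  csum (fun i => (u i + v i)%C) n = (csum u n + csum v n)%C.
Proof. induction n as [|n IH]; simpl; [|rewrite IH]; ring. Qed.

Lemma csum_scal (a : C) (u : nat -> C) (n : nat) :
  csum (fun i => (a * u i)%C) n = (a * csum u n)%C.
Proof. induction n as [|n IH]; simpl; [|rewrite IH]; ring. Qed.

Lemma csum_conj (u : nat -> C) (n : nat) :
  Cconj (csum u n) = csum (fun i => Cconj (u i)) n.
Proof.
  induction n as [|n IH]; simpl.
  - apply injective_projections; simpl; ring.
  - rewrite Cplus_conj, IH; reflexivity.
Qed.

Lemma csum_zero (u : nat -> C) (n : nat) :
  (forall i, (i < n)%nat -> u i = 0) -> csum u n = 0.
Proof.
  induction n as [|n IH]; intros H; simpl; [reflexivity|].
  rewrite IH, H; auto. ring.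
Qed.

Lemma csum_one (n : nat) : csum (fun _ => RtoC 1) n = RtoC (INR n).
Proof.
  induction n as [|n IH]; [reflexivity|].
  rewrite S_INR, RtoC_plus, <- IH. reflexivity.
Qed.

Lemma csum_Re_ge0 (u : nat -> C) (n : nat) :
  (forall i, 0 <= Re (u i)) -> 0 <= Re (csum u n).
Proof.
  intros H; induction n as [|n IH]; simpl; [lra|].
  specialize (H n); unfold Re in *; simpl; lra.
Qed.

Lemma csum_swap (u : nat -> nat -> C) (n m : nat) :
  csum (fun i => csum (fun j => u i j) m) n = csum (fun j => csum (fun i => u i j) n) m.
Proof.
  induction n as [|n IH]; simpl.
  - symmetry; apply csum_zero; auto.
  - rewrite IH, <- csum_plus. reflexivity.
Qed.

Lemma sum_n_csum (u : nat -> C) (n : nat) :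
  @sum_n C_AbelianMonoid u n = csum u (S n).
Proof.
  induction n as [|n IH].
  - rewrite sum_O. simpl. ring.
  - rewrite sum_Sn, IH. reflexivity.
Qed.

(** Stated through a real sequence, so that squeezing and real limit rules apply directly;
    [Ccv_filterlim] and [is_series_Ccv] link it to the filter-based notions of the statement. *)
Definition Ccv (u : nat -> C) (l : C) : Prop :=
  is_lim_seq (fun n => Cmod (u n - l)) 0.

Lemma is_lim_seq_squeeze0 (u v : nat -> R) :
  (exists n0, forall n, (n0 <= n)%nat -> Rabs (u n) <= v n) ->
  is_lim_seq v 0 -> is_lim_seq u 0.
Proof.
  intros [n0 H] Hv.
  apply is_lim_seq_le_le_loc with (u := fun n => - v n) (w := v); auto.
  - exists n0; intros n Hn. specialize (H n Hn). apply Rabs_le_between in H; lra.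
  - replace (Finite 0) with (Rbar_opp 0) by (simpl; f_equal; ring).
    now apply is_lim_seq_opp in Hv.
Qed.

Lemma Ccv_bound (u : nat -> C) (l : C) (v : nat -> R) :
  (exists n0, forall n, (n0 <= n)%nat -> Cmod (u n - l) <= v n) ->
  is_lim_seq v 0 -> Ccv u l.
Proof.
  intros [n0 H] Hv. apply is_lim_seq_squeeze0 with v; auto.
  exists n0; intros n Hn. rewrite Rabs_pos_eq by apply Cmod_ge_0. auto.
Qed.

Lemma Ccv_const (l : C) : Ccv (fun _ => l) l.
Proof.
  apply Ccv_bound with (fun _ => 0); [|apply is_lim_seq_const].
  exists O; intros n _. replace (l - l)%C with (RtoC 0) by ring. rewrite Cmod_0; lra.
Qed.

Lemma Ccv_ext (u v : nat -> C) (l : C) :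
  (exists n0, forall n, (n0 <= n)%nat -> u n = v n) -> Ccv u l -> Ccv v l.
Proof.
  intros [n0 H] Hu. apply Ccv_bound with (fun n => Cmod (u n - l)); auto.
  exists n0; intros n Hn. rewrite H by auto. lra.
Qed.

Lemma Ccv_eq (u : nat -> C) (l m : C) : l = m -> Ccv u l -> Ccv u m.
Proof. now intros <-. Qed.

Lemma Ccv_plus (u v : nat -> C) (l m : C) :
  Ccv u l -> Ccv v m -> Ccv (fun n => (u n + v n)%C) (l + m)%C.
Proof.
  intros Hu Hv.
  apply Ccv_bound with (fun n => Cmod (u n - l) + Cmod (v n - m)).
  - exists O; intros n _.
    replace (u n + v n - (l + m))%C with ((u n - l) + (v n - m))%C by ring.
    apply Cmod_triangle.
  - replace (Finite 0) with (Finite (0 + 0)) by (f_equal; ring).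
    now apply is_lim_seq_plus'.
Qed.

Lemma Ccv_mult (u v : nat -> C) (l m : C) :
  Ccv u l -> Ccv v m -> Ccv (fun n => (u n * v n)%C) (l * m)%C.
Proof.
  intros Hu Hv.
  apply Ccv_bound with
    (fun n => Cmod (u n - l) * Cmod (v n - m) + Cmod (u n - l) * Cmod m
              + Cmod l * Cmod (v n - m)).
  - exists O; intros n _.
    replace (u n * v n - l * m)%C
      with ((u n - l) * (v n - m) + (u n - l) * m + l * (v n - m))%C by ring.
    eapply Rle_trans; [apply Cmod_triangle|].
    rewrite Cmod_mult. apply Rplus_le_compat_r.
    eapply Rle_trans; [apply Cmod_triangle|].
    rewrite !Cmod_mult; lra.
  - replace (Finite 0) with (Finite (0 * 0 + 0 * Cmod m + Cmod l * 0)) by (f_equal; ring).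
    repeat apply is_lim_seq_plus'; apply is_lim_seq_mult'; auto; apply is_lim_seq_const.
Qed.

Lemma Ccv_conj (u : nat -> C) (l : C) :
  Ccv u l -> Ccv (fun n => Cconj (u n)) (Cconj l).
Proof.
  intros Hu. apply Ccv_bound with (fun n => Cmod (u n - l)); auto.
  exists O; intros n _. rewrite <- Cminus_conj, Cmod_conj; lra.
Qed.

Lemma Ccv_scal (a : C) (u : nat -> C) (l : C) :
  Ccv u l -> Ccv (fun n => (a * u n)%C) (a * l)%C.
Proof. intros; apply Ccv_mult; auto using Ccv_const. Qed.

Lemma Ccv_csum (u : nat -> nat -> C) (l : nat -> C) (m : nat) :
  (forall i, (i < m)%nat -> Ccv (fun n => u n i) (l i)) ->
  Ccv (fun n => csum (u n) m) (csum l m).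
Proof.
  induction m as [|m IH]; intros H; simpl; [apply Ccv_const|].
  apply (Ccv_plus (fun n => csum (u n) m) (fun n => u n m)); auto.
Qed.

Lemma Ccv_pow0 (a : C) : Cmod a < 1 -> Ccv (fun n => Cpow a n) 0.
Proof.
  intros Ha. apply Ccv_bound with (fun n => Cmod a ^ n).
  - exists O; intros n _.
    replace (a ^ n - 0)%C with (a ^ n)%C by ring. rewrite Cmod_pow; lra.
  - apply is_lim_seq_geom. now rewrite Rabs_pos_eq by apply Cmod_ge_0.
Qed.

(** Eventually [|u n| > |l| / 2], so [1/u - 1/l = -(u - l)/(u l)] costs at most a factor
    [2 / |l|^2]. *)
Lemma Ccv_inv (u : nat -> C) (l : C) :
  l <> 0 -> Ccv u l -> Ccv (fun n => (/ u n)%C) (/ l)%C.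
Proof.
  intros Hl Hu.
  assert (Hl' := proj1 (Cmod_gt_0 l) Hl).
  apply Ccv_bound with (fun n => Cmod (u n - l) * (2 / (Cmod l * Cmod l))).
  - assert (Hu' := Hu). apply is_lim_seq_spec in Hu'.
    assert (Hp : 0 < Cmod l / 2) by lra.
    destruct (Hu' (mkposreal _ Hp)) as [n0 Hn0]. exists n0; intros n Hn.
    specialize (Hn0 n Hn); simpl in Hn0.
    rewrite Rminus_0_r, Rabs_pos_eq in Hn0 by apply Cmod_ge_0.
    assert (Hge : Cmod l / 2 < Cmod (u n)).
    { assert (H := Cmod_triangle (u n) (- (u n - l))).
      rewrite Cmod_opp in H. replace (u n + - (u n - l))%C with l in H by ring. lra. }
    assert (Hun : u n <> 0).
    { apply Cmod_gt_0; lra. }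
    replace (/ u n - / l)%C with (- (u n - l) * / (u n * l))%C by (field; auto).
    rewrite Cmod_mult, Cmod_opp, Cmod_inv, Cmod_mult by (now apply Cmult_neq_0).
    apply Rmult_le_compat_l; [apply Cmod_ge_0|].
    replace (2 / (Cmod l * Cmod l)) with (/ (Cmod l / 2 * Cmod l)) by (field; lra).
    apply Rinv_le_contravar; [|apply Rmult_le_compat_r; lra].
    apply Rmult_lt_0_compat; lra.
  - replace (Finite 0) with (Finite (0 * (2 / (Cmod l * Cmod l)))) by (f_equal; ring).
    apply is_lim_seq_mult'; auto; apply is_lim_seq_const.
Qed.

Lemma Ccv_Re_ge0 (u : nat -> C) (l : C) :
  (exists n0, forall n, (n0 <= n)%nat -> 0 <= Re (u n)) -> Ccv u l -> 0 <= Re l.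
Proof.
  intros [n0 H] Hu.
  assert (Hlim : is_lim_seq (fun n => - Cmod (u n - l)) (Rbar_opp 0))
    by now apply is_lim_seq_opp in Hu.
  simpl in Hlim. rewrite Ropp_0 in Hlim.
  apply is_lim_seq_le_loc with (u := fun n => - Cmod (u n - l)) (v := fun _ => Re l)
    (l1 := Finite 0) (l2 := Finite (Re l)); auto using is_lim_seq_const.
  exists n0; intros n Hn. specialize (H n Hn).
  assert (Hr := re_le_Cmod (u n - l)). apply Rabs_le_between in Hr.
  unfold Re in *; simpl in Hr; lra.
Qed.

Lemma Ccv_Cmod_le (u : nat -> C) (l : C) (M : R) :
  (exists n0, forall n, (n0 <= n)%nat -> Cmod (u n) <= M) -> Ccv u l -> Cmod l <= M.
Proof.
  intros [n0 H] Hu.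
  assert (Hlim : is_lim_seq (fun n => Cmod (u n - l) + M) (0 + M))
    by (apply is_lim_seq_plus'; auto using is_lim_seq_const).
  rewrite Rplus_0_l in Hlim.
  apply is_lim_seq_le_loc with (u := fun _ => Cmod l) (v := fun n => Cmod (u n - l) + M)
    (l1 := Finite (Cmod l)) (l2 := Finite M); auto using is_lim_seq_const.
  exists n0; intros n Hn. specialize (H n Hn).
  assert (Ht := Cmod_triangle (u n) (- (u n - l))).
  rewrite Cmod_opp in Ht. replace (u n + - (u n - l))%C with l in Ht by ring. lra.
Qed.

Lemma Ccv_unique (u : nat -> C) (l m : C) : Ccv u l -> Ccv u m -> l = m.
Proof.
  intros Hl Hm.
  assert (H : Cmod (l - m) <= 0).
  { apply (Ccv_Cmod_le (fun n => (u n + - u n)%C)).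
    - exists O; intros n _. replace (u n + - u n)%C with (RtoC 0) by ring.
      rewrite Cmod_0; lra.
    - apply Ccv_plus; auto.
      apply Ccv_ext with (fun n => (- (1) * u n)%C); [exists O; intros; ring|].
      replace (- m)%C with (- (1) * m)%C by ring. now apply Ccv_scal. }
  assert (H0 := Cmod_ge_0 (l - m)).
  assert (E : (l - m)%C = 0) by (apply Cmod_eq_0; lra).
  replace l with ((l - m) + m)%C by ring. rewrite E; ring.
Qed.

Lemma Ccv_filterlim (u : nat -> C) (l : C) :
  filterlim u eventually (locally l) <-> Ccv u l.
Proof.
  split.
  - intros H. apply is_lim_seq_spec. intros eps.
    (* A ball of [C] is a product of two intervals; at radius [eps / sqrt 2] it fits in the disc of
       radius [eps]. *)
    assert (Hp : 0 < eps / sqrt 2).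
    { apply Rdiv_lt_0_compat; [apply cond_pos|apply Rlt_sqrt2_0]. }
    destruct (H (ball l (mkposreal _ Hp)) (locally_ball l (mkposreal _ Hp))) as [n0 Hn0].
    exists n0; intros n Hn. specialize (Hn0 n Hn).
    rewrite Rminus_0_r, Rabs_pos_eq by apply Cmod_ge_0.
    assert (Hb := C_NormedModule_mixin_compat2 l (u n) (mkposreal _ Hp) Hn0).
    simpl in Hb. replace (sqrt 2 * (eps / sqrt 2)) with (pos eps) in Hb;
      [exact Hb|field; apply Rgt_not_eq, Rlt_sqrt2_0].
  - intros H P [eps HP]. apply is_lim_seq_spec in H.
    destruct (H eps) as [n0 Hn0]. exists n0; intros n Hn. apply HP.
    apply C_NormedModule_mixin_compat1. specialize (Hn0 n Hn).
    rewrite Rminus_0_r, Rabs_pos_eq in Hn0 by apply Cmod_ge_0. exact Hn0.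
Qed.

Lemma is_series_Ccv (a : nat -> C) (l : C) :
  is_series (K := C_AbsRing) (V := C_NormedModule) a l <-> Ccv (csum a) l.
Proof.
  assert (E : forall n, @sum_n C_AbelianMonoid a n = csum a (S n)) by apply sum_n_csum.
  assert (Hs : is_series (K := C_AbsRing) (V := C_NormedModule) a l
               <-> Ccv (fun n => csum a (S n)) l).
  { rewrite <- Ccv_filterlim. unfold is_series. split; intros H P HP.
    - destruct (H P HP) as [n0 Hn0].
      exists n0; intros n Hn. rewrite <- E. now apply Hn0.
    - destruct (H P HP) as [n0 Hn0].
      exists n0; intros n Hn. specialize (Hn0 n Hn). rewrite <- E in Hn0. exact Hn0. }
  rewrite Hs. unfold Ccv.
  symmetry; apply (is_lim_seq_incr_1 (fun n => Cmod (csum a n - l))).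
Qed.

(** * Averages over roots of unity *)

Definition rou (N j : nat) : C :=
  (cos (INR j * (2 * PI / INR N)), sin (INR j * (2 * PI / INR N))).

Lemma rou_mod (N j : nat) : Cmod (rou N j) = 1.
Proof.
  unfold Cmod, rou; simpl fst; simpl snd.
  rewrite <- !Rsqr_pow2, Rplus_comm, sin2_cos2. apply sqrt_1.
Qed.

Lemma rou_plus (N i j : nat) : rou N (i + j) = (rou N i * rou N j)%C.
Proof.
  unfold rou. rewrite plus_INR, Rmult_plus_distr_r, cos_plus, sin_plus.
  apply injective_projections; simpl; ring.
Qed.

Lemma rou_0 (N : nat) : rou N 0 = 1.
Proof.
  unfold rou. simpl INR. rewrite Rmult_0_l, cos_0, sin_0. reflexivity.
Qed.

Lemma rou_pow (N j k : nat) : Cpow (rou N j) k = rou N (j * k).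
Proof.
  induction k as [|k IH].
  - rewrite Nat.mul_0_r, rou_0. reflexivity.
  - rewrite Cpow_S, IH, <- rou_plus. f_equal; lia.
Qed.

Lemma rou_N (N : nat) : (0 < N)%nat -> rou N N = 1.
Proof.
  intros HN. unfold rou.
  assert (INR N <> 0) by (apply not_0_INR; lia).
  replace (INR N * (2 * PI / INR N)) with (2 * PI) by (field; auto).
  rewrite cos_2PI, sin_2PI. reflexivity.
Qed.

Lemma rou_pow_N (N j : nat) : (0 < N)%nat -> Cpow (rou N j) N = 1.
Proof.
  intros HN. rewrite rou_pow, Nat.mul_comm, <- rou_pow, rou_N, Cpow_1_l; auto.
Qed.

(** With [t = PI * k / N] strictly between [0] and [PI], the real part is [1 - 2 sin^2 t < 1]. *)
Lemma rou_neq_1 (N k : nat) : (0 < k < N)%nat -> rou N k <> 1.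
Proof.
  intros Hk E. apply (f_equal fst) in E. unfold rou in E; simpl in E.
  assert (HN : 0 < INR N) by (apply lt_0_INR; lia).
  assert (Hk0 : 0 < INR k) by (apply lt_0_INR; lia).
  assert (HkN : INR k < INR N) by (apply lt_INR; lia).
  set (t := PI * (INR k / INR N)).
  replace (INR k * (2 * PI / INR N)) with (2 * t) in E by (unfold t; field; lra).
  rewrite cos_2a_sin in E.
  assert (HPI := PI_RGT_0).
  assert (Ht : 0 < INR k / INR N < 1).
  { split; [now apply Rdiv_lt_0_compat|]. apply Rlt_div_l; lra. }
  assert (0 < sin t) by (apply sin_gt_0; unfold t; nra).
  nra.
Qed.

Lemma rou_sum_pow (N k : nat) :
  (0 < k < N)%nat -> csum (fun j => Cpow (rou N j) k) N = 0.
Proof.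
  intros Hk. set (w := rou N k).
  assert (E : forall n, ((w - 1) * csum (fun j => Cpow (rou N j) k) n = Cpow w n - 1)%C).
  { induction n as [|n IH]; simpl; [ring|].
    rewrite Cmult_plus_distr_l, IH, rou_pow, Nat.mul_comm, <- rou_pow. fold w. ring. }
  specialize (E N). unfold w at 2 in E. rewrite rou_pow_N in E by lia.
  apply NNPP; intros H. apply (Cmult_neq_0 (w - 1) _) in H.
  - apply H. rewrite E. ring.
  - intros E'. apply (rou_neq_1 N k); auto. fold w.
    replace w with ((w - 1) + 1)%C by ring. rewrite E'. ring.
Qed.

Lemma Cmod1_conj (z : C) : Cmod z = 1 -> (z * Cconj z)%C = 1.
Proof. intros H. rewrite <- Cmod2_conj, H. simpl. f_equal. ring. Qed.

Lemma C1_minus_neq_0 (z : C) : Cmod z < 1 -> (1 - z)%C <> 0.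
Proof.
  intros H E. assert (z = 1) by (replace z with (1 - (1 - z))%C by ring; rewrite E; ring).
  subst. rewrite Cmod_1 in H. lra.
Qed.

Lemma Cmod_mult_lt_1 (a b : C) : Cmod a < 1 -> Cmod b <= 1 -> Cmod (a * b) < 1.
Proof.
  intros. rewrite Cmod_mult. assert (Ha := Cmod_ge_0 a). assert (Hb := Cmod_ge_0 b). nra.
Qed.

(* [z / (1 - b conj z) = z + b / (1 - b conj z)] on the circle turns the sums over
   [m] into a geometric progression that closes up at [m = N]. *)
Lemma rou_sum_kernel (N m : nat) (b : C) :
  (m < N)%nat -> Cmod b < 1 ->
  csum (fun j => (Cpow (rou N j) m * / (1 - b * Cconj (rou N j)))%C) N
    = (RtoC (INR N) * (Cpow b m * / (1 - Cpow b N)))%C.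
Proof.
  intros Hm Hb.
  set (S := fun m => csum (fun j => (Cpow (rou N j) m * / (1 - b * Cconj (rou N j)))%C) N).
  assert (Hrec : forall m, S (Datatypes.S m) = (csum (fun j => Cpow (rou N j) (Datatypes.S m)) N + b * S m)%C).
  { intros n. unfold S. rewrite <- csum_scal, <- csum_plus. apply csum_ext; intros j _.
    assert (Hz := Cmod1_conj _ (rou_mod N j)).
    assert (Hn : (1 - b * Cconj (rou N j))%C <> 0).
    { apply C1_minus_neq_0, Cmod_mult_lt_1; auto. rewrite Cmod_conj, rou_mod; lra. }
    set (z := rou N j) in *. set (z' := Cconj z) in *.
    rewrite Cpow_S.
    transitivity (z ^ n * (z * / (1 - b * z')))%C; [ring|].
    transitivity (z ^ n * (z + b * / (1 - b * z')))%C; [f_equal|ring].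
    transitivity ((z * (1 - b * z') + b * (z * z')) * / (1 - b * z'))%C.
    - f_equal. ring.
    - rewrite Hz. field. auto. }
  assert (HS : forall n, (n < N)%nat -> S n = (b ^ n * S 0%nat)%C).
  { induction n as [|n IH]; intros Hn; [simpl; ring|].
    rewrite Hrec, rou_sum_pow, IH by lia. rewrite Cpow_S. ring. }
  assert (HN : S N = S 0%nat).
  { apply csum_ext; intros j _. rewrite rou_pow_N by lia. reflexivity. }
  assert (Hbn : (1 - b ^ N)%C <> 0).
  { apply C1_minus_neq_0. rewrite Cmod_pow. apply pow_lt_1_compat; [split; auto using Cmod_ge_0|lia]. }
  (* The last step of the recursion meets the power sum of exponent [N], which is [N] and not [0];
     with [S N = S 0] this reads [S 0 = N + b^N S 0]. *)
  assert (H0 : S 0%nat = (RtoC (INR N) * / (1 - b ^ N))%C).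
  { destruct N as [|N]; [lia|].
    rewrite Hrec, HS in HN by lia.
    rewrite (csum_ext _ (fun _ => RtoC 1)) in HN by (intros; apply rou_pow_N; lia).
    rewrite csum_one in HN.
    transitivity ((S 0%nat - b * (b ^ N * S 0%nat)) * / (1 - b ^ (Datatypes.S N)))%C.
    - rewrite Cpow_S in *. field. auto.
    - f_equal. rewrite <- HN at 1. ring. }
  fold (S m). rewrite HS, H0 by auto. ring.
Qed.

Definition ravg (N : nat) (u : C -> C) : C :=
  (/ RtoC (INR N) * csum (fun j => u (rou N j)) N)%C.

Lemma ravg_ext (N : nat) (u v : C -> C) :
  (forall z, Cmod z = 1 -> u z = v z) -> ravg N u = ravg N v.
Proof.
  intros H. unfold ravg. f_equal. apply csum_ext; intros j _. apply H, rou_mod.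
Qed.

Lemma ravg_plus (N : nat) (u v : C -> C) :
  ravg N (fun z => (u z + v z)%C) = (ravg N u + ravg N v)%C.
Proof. unfold ravg. rewrite csum_plus. ring. Qed.

Lemma ravg_scal (N : nat) (a : C) (u : C -> C) :
  ravg N (fun z => (a * u z)%C) = (a * ravg N u)%C.
Proof. unfold ravg. rewrite csum_scal. ring. Qed.

Lemma ravg_csum (N m : nat) (u : nat -> C -> C) :
  ravg N (fun z => csum (fun i => u i z) m) = csum (fun i => ravg N (u i)) m.
Proof.
  unfold ravg. rewrite csum_swap, <- csum_scal. reflexivity.
Qed.

Lemma RtoC_INR_conj (N : nat) : Cconj (/ RtoC (INR N)) = (/ RtoC (INR N))%C.
Proof. apply injective_projections; simpl; unfold Rdiv; ring. Qed.

Lemma ravg_conj (N : nat) (u : C -> C) :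
  ravg N (fun z => Cconj (u z)) = Cconj (ravg N u).
Proof. unfold ravg. rewrite Cmult_conj, csum_conj, RtoC_INR_conj. reflexivity. Qed.

Lemma RtoC_INR_neq_0 (N : nat) : (0 < N)%nat -> RtoC (INR N) <> 0.
Proof. intros H E. apply RtoC_inj in E. apply (not_0_INR N); auto. lia. Qed.

Lemma ravg_Re_ge0 (N : nat) (u : C -> C) :
  (forall z, Cmod z = 1 -> 0 <= Re (u z)) -> 0 <= Re (ravg N u).
Proof.
  intros H. unfold ravg.
  destruct N as [|N]; [simpl; unfold Re; simpl; lra|].
  rewrite <- RtoC_inv by (apply not_0_INR; lia).
  assert (H0 : 0 < / INR (S N)) by (apply Rinv_0_lt_compat, lt_0_INR; lia).
  assert (H1 := csum_Re_ge0 (fun j => u (rou (S N) j)) (S N) (fun j => H _ (rou_mod (S N) j))).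
  revert H0 H1. generalize (/ INR (S N)), (csum (fun j => u (rou (S N) j)) (S N)).
  intros r c H0 H1. unfold Re in *; simpl. nra.
Qed.

Lemma ravg_kernel (N m : nat) (b : C) :
  (m < N)%nat -> Cmod b < 1 ->
  ravg N (fun z => (Cpow z m * / (1 - b * Cconj z))%C) = (Cpow b m * / (1 - Cpow b N))%C.
Proof.
  intros Hm Hb. unfold ravg. rewrite rou_sum_kernel by auto. 
  assert (Hn := RtoC_INR_neq_0 N ltac:(lia)).
  rewrite Cmult_assoc, Cinv_l by auto. ring.
Qed.

(** On the [N]-th roots of unity [z^m] is the conjugate of [z^(N - m)], so this is a conjugated
    instance of [ravg_kernel]; [0 < m] keeps the exponent [N - m] below [N]. *)
Lemma ravg_kernel_conj (N m : nat) (a : C) :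
  (0 < m <= N)%nat -> Cmod a < 1 ->
  ravg N (fun z => (Cpow z m * / (1 - Cconj a * z))%C)
    = Cconj (Cpow a (N - m) * / (1 - Cpow a N))%C.
Proof.
  intros Hm Ha. rewrite <- (ravg_kernel N (N - m) a) by (auto; lia).
  rewrite <- ravg_conj. unfold ravg. f_equal. apply csum_ext; intros j _.
  rewrite Cmult_conj, Cinv_conj, Cminus_conj, Cmult_conj, Cconj_conj.
  2:{ apply C1_minus_neq_0, Cmod_mult_lt_1; auto. rewrite Cmod_conj, rou_mod; lra. }
  rewrite Cconj_1.
  f_equal. rewrite Cpow_conj.
  assert (Hz := Cmod1_conj _ (rou_mod N j)).
  assert (HN := rou_pow_N N j ltac:(lia)).
  transitivity (rou N j ^ m * (rou N j * Cconj (rou N j)) ^ (N - m))%C.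
  - rewrite Hz, Cpow_1_l. ring.
  - rewrite Cpow_mult_l, Cmult_assoc, <- Cpow_add_r.
    replace (m + (N - m))%nat with N by lia. rewrite HN. ring.
Qed.

Lemma ravg_pow (N m : nat) : (0 < m < N)%nat -> ravg N (fun z => Cpow z m) = 0.
Proof. intros H. unfold ravg. rewrite rou_sum_pow by auto. ring. Qed.

Lemma ravg_one (N : nat) : (0 < N)%nat -> ravg N (fun _ => RtoC 1) = 1.
Proof. intros H. unfold ravg. rewrite csum_one. apply Cinv_l, RtoC_INR_neq_0, H. Qed.

Lemma Ccv_pow_shift (a : C) (m : nat) :
  Cmod a < 1 -> Ccv (fun N => Cpow a (N - m)) 0.
Proof.
  intros Ha. unfold Ccv. apply is_lim_seq_incr_n with m.
  eapply is_lim_seq_ext; [|exact (Ccv_pow0 a Ha)].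
  intros n; simpl. replace (n + m - m)%nat with n by lia. reflexivity.
Qed.

(** With [k_a(z) = 1 / (1 - conj a z)], this is the reproducing property
    [<z^m k_a, k_b> = b^m k_a(b)] on the circle. *)
Lemma ravg_two_kernels (m : nat) (a b : C) :
  Cmod a < 1 -> Cmod b < 1 ->
  Ccv (fun N => ravg N (fun z =>
         (Cpow z m * / ((1 - Cconj a * z) * (1 - b * Cconj z)))%C))
      (Cpow b m * / (1 - Cconj a * b))%C.
Proof.
  intros Ha Hb.
  assert (Hab : (1 - Cconj a * b)%C <> 0).
  { apply C1_minus_neq_0, Cmod_mult_lt_1; [rewrite Cmod_conj|]; lra. }
  assert (Hinv : forall c, Cmod c < 1 -> Ccv (fun N => / (1 - Cpow c N))%C (/ (1 - 0))%C).
  { intros c Hc. apply Ccv_inv.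
    - intros E. apply C1_nz. replace (RtoC 1) with (1 - 0)%C by ring. exact E.
    - apply Ccv_ext with (fun n => (1 + - (1) * c ^ n)%C); [exists O; intros; ring|].
      replace (1 - 0)%C with (1 + - (1) * 0)%C by ring.
      apply Ccv_plus; auto using Ccv_const, Ccv_scal, Ccv_pow0. }
  (* partial fractions: [1/((1-a'z)(1-bz')) = (1/(1-a'z) + 1/(1-bz') - 1)/(1-a'b)] when [zz'=1] *)
  assert (Hsplit : forall N, ravg N (fun z =>
         (Cpow z m * / ((1 - Cconj a * z) * (1 - b * Cconj z)))%C)
    = (/ (1 - Cconj a * b) * (ravg N (fun z => (Cpow z m * / (1 - Cconj a * z))%C)
        + ravg N (fun z => (Cpow z m * / (1 - b * Cconj z))%C)
        + - (1) * ravg N (fun z => Cpow z m)))%C).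
  { intros N. rewrite <- ravg_scal, <- !ravg_plus, <- ravg_scal.
    apply ravg_ext. intros z Hz.
    assert (H1 : (1 - Cconj a * z)%C <> 0).
    { apply C1_minus_neq_0, Cmod_mult_lt_1; rewrite ?Cmod_conj; lra. }
    assert (H2 : (1 - b * Cconj z)%C <> 0).
    { apply C1_minus_neq_0, Cmod_mult_lt_1; rewrite ?Cmod_conj; lra. }
    apply Cmod1_conj in Hz. set (z' := Cconj z) in *. set (a' := Cconj a) in *.
    transitivity (z ^ m * (/ (1 - a' * b) *
       ((1 - a' * b * (z * z')) * / ((1 - a' * z) * (1 - b * z')))))%C.
    - rewrite Hz. field. repeat split; auto.
    - field. repeat split; auto. }
  apply Ccv_ext with (1 := ex_intro _ O (fun n _ => eq_sym (Hsplit n))).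
  replace (b ^ m * / (1 - Cconj a * b))%C with (/ (1 - Cconj a * b) * b ^ m)%C by ring.
  apply Ccv_scal.
  assert (E1 : (/ (1 - 0))%C = 1).
  { replace (1 - 0)%C with (RtoC 1) by ring. rewrite <- RtoC_inv, Rinv_1 by lra. reflexivity. }
  (* For [m = 0] the three averages all tend to [1], giving [1 + 1 - 1]; for [m > 0] only the kernel
     in [b] survives, with limit [b^m]. *)
  destruct m as [|m].
  - apply Ccv_ext with (fun N => Cconj (/ (1 - a ^ N)) + / (1 - b ^ N) + - (1) * 1)%C.
    + exists 1%nat. intros N HN. f_equal; [f_equal|].
      * rewrite <- (ravg_ext N (fun z => Cconj (z ^ 0 * / (1 - a * Cconj z)))).
        -- rewrite ravg_conj, ravg_kernel by (auto; lia). f_equal. simpl. ring.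
        -- intros z Hz. rewrite Cmult_conj, Cinv_conj, Cminus_conj, Cmult_conj, Cconj_conj.
           ++ simpl. now rewrite Cconj_1.
           ++ apply C1_minus_neq_0, Cmod_mult_lt_1; rewrite ?Cmod_conj; lra.
      * rewrite ravg_kernel by (auto; lia). simpl. ring.
      * f_equal. symmetry. apply (ravg_one N). lia.
    + replace (b ^ 0)%C with (Cconj (/ (1 - 0)) + / (1 - 0) + - (1) * 1)%C.
      * repeat apply Ccv_plus; auto using Ccv_const, Ccv_conj.
      * rewrite E1. apply injective_projections; simpl; ring.
  - apply Ccv_ext with (fun N => Cconj (a ^ (N - S m) * / (1 - a ^ N))
      + b ^ S m * / (1 - b ^ N) + - (1) * 0)%C.
    + exists (S (S m)). intros N HN.
      rewrite ravg_kernel_conj, ravg_kernel, ravg_pow by (auto; lia). reflexivity.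
    + apply Ccv_eq with (Cconj (0 * / (1 - 0)) + b ^ S m * / (1 - 0) + - (1) * 0)%C.
      * rewrite E1. apply injective_projections; simpl; ring.
      * repeat apply Ccv_plus; auto using Ccv_const.
        -- apply Ccv_conj, Ccv_mult; auto using Ccv_pow_shift.
        -- apply Ccv_scal; auto.
Qed.

(** * Power series and positive kernels *)

Definition poly (a : nat -> C) (n : nat) (z : C) : C :=
  csum (fun k => (a k * Cpow z k)%C) n.

Lemma is_coef_Ccv (a : nat -> C) (f : C -> C) (z : C) :
  is_coef a f -> inD z -> Ccv (fun n => poly a n z) (f z).
Proof. intros H Hz. apply is_series_Ccv, H, Hz. Qed.

(** The conjugate of [z^n] is [z^(N - n)] at these points, and [i + (N - n)] lies strictly between
    [0] and [N]. *)
Lemma ravg_pow_conj (N i n : nat) :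
  (i < n < N)%nat -> ravg N (fun z => (Cpow z i * Cconj (Cpow z n))%C) = 0.
Proof.
  intros Hi. rewrite <- (ravg_pow N (i + (N - n))) by lia.
  unfold ravg. f_equal. apply csum_ext; intros j _.
  assert (Hz := Cmod1_conj _ (rou_mod N j)).
  assert (HN := rou_pow_N N j ltac:(lia)).
  rewrite Cpow_add_r, Cpow_conj. f_equal. set (z := rou N j) in *.
  transitivity (z ^ (n + (N - n)) * Cconj z ^ n)%C.
  - replace (n + (N - n))%nat with N by lia. rewrite HN. ring.
  - rewrite Cpow_add_r.
    transitivity ((z * Cconj z) ^ n * z ^ (N - n))%C; [rewrite Cpow_mult_l; ring|].
    rewrite Hz, Cpow_1_l. ring.
Qed.

(** Exact at finite [N]: distinct frequencies below [n <= N] stay orthogonal on the [N]-th roots, so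
    each induction step adds one square and no cross term. *)
Lemma poly_parseval (a : nat -> C) (n N : nat) :
  (n <= N)%nat ->
  ravg N (fun z => (poly a n z * Cconj (poly a n z))%C)
    = csum (fun k => RtoC (Cmod (a k) ^ 2)) n.
Proof.
  induction n as [|n IH]; intros Hn.
  - unfold ravg, poly. simpl. rewrite csum_zero; [ring|]. intros; ring.
  - assert (H0 : ravg N (fun z => (poly a n z * Cconj (Cpow z n))%C) = 0).
    { transitivity (csum (fun i => a i * ravg N (fun z => (Cpow z i * Cconj (Cpow z n))%C))%C n).
      - rewrite (csum_ext _ (fun i => ravg N (fun z => (a i * (Cpow z i * Cconj (Cpow z n)))%C)))
          by (intros; symmetry; apply ravg_scal).
        rewrite <- ravg_csum. apply ravg_ext; intros z _. unfold poly.
        rewrite Cmult_comm, <- csum_scal. apply csum_ext; intros; ring.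
      - apply csum_zero; intros i Hi. rewrite ravg_pow_conj by lia. ring. }
    change (csum (fun k => RtoC (Cmod (a k) ^ 2)) (S n))
      with (csum (fun k => RtoC (Cmod (a k) ^ 2)) n + RtoC (Cmod (a n) ^ 2))%C.
    rewrite <- IH by lia. rewrite Cmod2_conj.
    transitivity (ravg N (fun z =>
       (poly a n z * Cconj (poly a n z)
        + Cconj (a n) * (poly a n z * Cconj (Cpow z n))
        + a n * Cconj (poly a n z * Cconj (Cpow z n))
        + a n * Cconj (a n) * 1)%C)).
    + apply ravg_ext; intros z Hz.
      assert (E : poly a (S n) z = (poly a n z + a n * Cpow z n)%C) by reflexivity.
      rewrite E. rewrite Cplus_conj, !Cmult_conj, Cconj_conj.
      assert (E1 : (Cpow z n * Cconj (Cpow z n))%C = 1).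
      { apply Cmod1_conj. rewrite Cmod_pow, Hz. apply pow1. }
      rewrite <- E1. ring.
    + rewrite !ravg_plus, !ravg_scal, ravg_conj, H0, ravg_one by lia.
      replace (Cconj 0) with (RtoC 0) by (apply injective_projections; simpl; ring). ring.
Qed.

Lemma csum_RtoC (u : nat -> R) (n : nat) :
  csum (fun k => RtoC (u k)) (S n) = RtoC (sum_n u n).
Proof.
  induction n as [|n IH].
  - rewrite sum_O. simpl. ring.
  - rewrite sum_Sn. simpl in *. rewrite IH, <- RtoC_plus. reflexivity.
Qed.

Lemma sum_n_incr (u : nat -> R) (n N : nat) :
  (forall k, 0 <= u k) -> (n <= N)%nat -> sum_n u n <= sum_n u N.
Proof.
  intros Hu HN. induction HN as [|N HN IH]; [lra|].
  rewrite sum_Sn. specialize (Hu (S N)). unfold plus; simpl. lra.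
Qed.

Lemma poly_coef_bound (a : nat -> C) (n : nat) (M : R) :
  (forall z, Cmod z = 1 -> Cmod (poly a (S n) z) <= M) ->
  sum_n (fun k => Cmod (a k) ^ 2) n <= M ^ 2.
Proof.
  intros HM.
  assert (H : 0 <= Re (ravg (S n) (fun z => (RtoC (M ^ 2) * 1
     + RtoC (-1) * (poly a (S n) z * Cconj (poly a (S n) z)))%C))).
  { apply ravg_Re_ge0. intros z Hz. rewrite <- Cmod2_conj, Re_plus, !Re_scal, !re_RtoC.
    specialize (HM z Hz). assert (H0 := Cmod_ge_0 (poly a (S n) z)).
    assert (Cmod (poly a (S n) z) ^ 2 <= M ^ 2) by (apply pow_incr; lra). lra. }
  rewrite ravg_plus, !ravg_scal, ravg_one, poly_parseval, csum_RtoC in H by lia.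
  rewrite Re_plus, !Re_scal, !re_RtoC in H. lra.
Qed.

(** The term [a n * s^n] is the difference of two consecutive partial sums at [s], both of which
    approach [f s]. *)
Lemma coef_eventually_small (a : nat -> C) (f : C -> C) (s : R) :
  is_coef a f -> 0 <= s < 1 ->
  exists n0, forall n, (n0 <= n)%nat -> Cmod (a n) * s ^ n <= 1.
Proof.
  intros Ha Hs.
  assert (Hin : inD (RtoC s)).
  { unfold inD. rewrite Cmod_R, Rabs_pos_eq; lra. }
  assert (H := is_coef_Ccv a f s Ha Hin). unfold Ccv in H.
  assert (H' := proj1 (is_lim_seq_incr_1 _ _) H).
  assert (Hs' := is_lim_seq_plus' _ _ _ _ H' H). rewrite Rplus_0_r in Hs'.
  apply is_lim_seq_spec in Hs'. destruct (Hs' (mkposreal 1 Rlt_0_1)) as [n0 Hn0].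
  exists n0; intros n Hn. specialize (Hn0 n Hn). simpl pos in Hn0.
  rewrite Rminus_0_r in Hn0. apply Rabs_lt_between in Hn0.
  replace (Cmod (a n) * s ^ n) with (Cmod (poly a (S n) s - f s + - (poly a n s - f s))%C).
  - eapply Rle_trans; [apply Cmod_triangle|]. rewrite Cmod_opp. lra.
  - replace (poly a (S n) s - f s + - (poly a n s - f s))%C with (a n * Cpow s n)%C
      by (unfold poly; simpl; ring).
    rewrite Cmod_mult, Cmod_pow, Cmod_R, Rabs_pos_eq; lra.
Qed.

(** The error must not depend on [z], because it is used on a whole circle at once. Coefficients are
    bounded through an intermediate radius [s] between [r] and [1], which leaves a geometric tail of
    ratio [q = r / s]. *)
Lemma coef_tail (a : nat -> C) (f : C -> C) (r : R) :
  is_coef a f -> 0 <= r < 1 ->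
  exists (e : nat -> R) (n0 : nat), is_lim_seq e 0 /\
    forall n z, (n0 <= n)%nat -> Cmod z <= r -> Cmod (poly a n z - f z) <= e n.
Proof.
  intros Ha Hr.
  set (s := (1 + r) / 2). set (q := r / s).
  assert (Hs : 0 < s < 1) by (unfold s; lra).
  assert (Hq : 0 <= q < 1).
  { unfold q; split; [apply Rdiv_le_0_compat; lra|]. apply Rlt_div_l; unfold s; lra. }
  destruct (coef_eventually_small a f s Ha) as [n0 Hn0]; [lra|].
  exists (fun n => q ^ n * / (1 - q)), n0. split.
  { replace (Finite 0) with (Finite (0 * / (1 - q))) by (f_equal; ring).
    apply is_lim_seq_mult'; [|apply is_lim_seq_const].
    apply is_lim_seq_geom. rewrite Rabs_pos_eq; lra. }
  intros n z Hn Hz.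
  assert (Hterm : forall k, (n0 <= k)%nat -> Cmod (a k * Cpow z k) <= q ^ k).
  { intros k Hk. rewrite Cmod_mult, Cmod_pow.
    apply Rle_trans with (Cmod (a k) * r ^ k).
    - apply Rmult_le_compat_l; [apply Cmod_ge_0|]. apply pow_incr; split; auto using Cmod_ge_0.
    - replace r with (q * s) by (unfold q; field; lra). rewrite Rpow_mult_distr.
      specialize (Hn0 k Hk). assert (0 <= q ^ k) by (apply pow_le; lra).
      nra. }
  assert (Hpart : forall m, Cmod (poly a n z - poly a (n + m) z) <= q ^ n * (1 - q ^ m) * / (1 - q)).
  { induction m as [|m IH].
    - rewrite Nat.add_0_r. replace (poly a n z - poly a n z)%C with (RtoC 0) by ring.
      rewrite Cmod_0. simpl. lra.
    - rewrite Nat.add_succ_r.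
      replace (poly a n z - poly a (S (n + m)) z)%C
        with ((poly a n z - poly a (n + m) z) + - (a (n + m)%nat * Cpow z (n + m)))%C
        by (unfold poly; simpl; ring).
      eapply Rle_trans; [apply Cmod_triangle|]. rewrite Cmod_opp.
      specialize (Hterm (n + m)%nat ltac:(lia)). rewrite pow_add in Hterm.
      replace (q ^ n * (1 - q ^ S m) * / (1 - q))
        with (q ^ n * (1 - q ^ m) * / (1 - q) + q ^ n * q ^ m) by (simpl; field; lra).
      lra. }
  apply Ccv_Cmod_le with (u := fun k => (poly a n z + - (1) * poly a k z)%C).
  - exists n; intros k Hk. specialize (Hpart (k - n)%nat).
    replace (n + (k - n))%nat with k in Hpart by lia.
    replace (poly a n z + - (1) * poly a k z)%C with (poly a n z - poly a k z)%C by ring.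
    eapply Rle_trans; [exact Hpart|].
    apply Rmult_le_compat_r; [apply Rlt_le, Rinv_0_lt_compat; lra|].
    assert (0 <= q ^ n) by (apply pow_le; lra).
    assert (0 <= q ^ (k - n)) by (apply pow_le; lra). nra.
  - replace (poly a n z - f z)%C with (poly a n z + - (1) * f z)%C by ring.
    apply Ccv_plus; [apply Ccv_const|apply Ccv_scal, is_coef_Ccv; auto].
    unfold inD; lra.
Qed.

Definition rad (m : nat) : R := 1 - / (INR m + 2).

Lemma rad_bound (m : nat) : 0 <= rad m < 1.
Proof.
  unfold rad. assert (H := pos_INR m).
  assert (0 < / (INR m + 2)) by (apply Rinv_0_lt_compat; lra).
  assert (/ (INR m + 2) <= / 1) by (apply Rinv_le_contravar; lra).
  rewrite Rinv_1 in *. lra.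
Qed.

Lemma rad_lim : Ccv (fun m => RtoC (rad m)) 1.
Proof.
  apply Ccv_bound with (fun m => / INR m).
  - exists 1%nat; intros m Hm. rewrite <- RtoC_minus, Cmod_R. unfold rad.
    assert (0 < INR m) by (apply lt_0_INR; lia).
    replace (1 - / (INR m + 2) - 1) with (- / (INR m + 2)) by ring.
    rewrite Rabs_Ropp, Rabs_pos_eq.
    + apply Rinv_le_contravar; lra.
    + apply Rlt_le, Rinv_0_lt_compat; lra.
  - apply (is_lim_seq_inv INR p_infty); [apply is_lim_seq_INR|discriminate].
Qed.

Lemma Ccv_pow (u : nat -> C) (l : C) (k : nat) :
  Ccv u l -> Ccv (fun n => Cpow (u n) k) (Cpow l k).
Proof.
  intros H; induction k as [|k IH]; [exact (Ccv_const 1)|].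
  apply (Ccv_mult u (fun n => Cpow (u n) k)); auto.
Qed.

Lemma poly_scale (a : nat -> C) (n : nat) (r : R) (z : C) :
  poly (fun k => (a k * RtoC (r ^ k))%C) n z = poly a n (r * z)%C.
Proof.
  apply csum_ext; intros k _. rewrite Cpow_mult_l, <- RtoC_pow. ring.
Qed.

Lemma Cmod_scale_lt (r : R) (z : C) : 0 <= r < 1 -> Cmod z <= 1 -> Cmod (r * z) <= r.
Proof.
  intros Hr Hz. rewrite Cmod_mult, Cmod_R, Rabs_pos_eq by lra.
  assert (H := Cmod_ge_0 z). nra.
Qed.

(** The Hardy norm is at most the supremum norm. Partial sums of [f (r * z)] need not be bounded by
    [M], only by [M + e N], so Parseval is followed by the limit in [N] and then in [r], with [n]
    fixed. *)
Lemma coef_square_sum_bound (a : nat -> C) (f : C -> C) (M : R) (n : nat) :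
  is_coef a f -> (forall z, inD z -> Cmod (f z) <= M) ->
  sum_n (fun k => Cmod (a k) ^ 2) n <= M ^ 2.
Proof.
  intros Ha HM.
  assert (Hr : forall m, sum_n (fun k => Cmod (a k * RtoC (rad m ^ k)) ^ 2) n <= M ^ 2).
  { intros m. assert (Hb := rad_bound m). set (r := rad m) in *.
    destruct (coef_tail a f r Ha Hb) as (e & n0 & He & Htail).
    assert (Hlim : is_lim_seq (fun N => (M + e N) * (M + e N)) ((M + 0) * (M + 0))).
    { apply is_lim_seq_mult'; apply is_lim_seq_plus'; auto using is_lim_seq_const. }
    apply is_lim_seq_le_loc with (u := fun _ => sum_n (fun k => Cmod (a k * RtoC (r ^ k)) ^ 2) n)
      (l1 := Finite (sum_n (fun k => Cmod (a k * RtoC (r ^ k)) ^ 2) n))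
      (l2 := Finite (M ^ 2)) (v := fun N => (M + e N) * (M + e N));
      [|apply is_lim_seq_const|now replace (M ^ 2) with ((M + 0) * (M + 0)) by ring].
    exists (n0 + S n)%nat; intros N HN. destruct N as [|N]; [lia|].
    apply Rle_trans with (sum_n (fun k => Cmod (a k * RtoC (r ^ k)) ^ 2) N).
    - apply sum_n_incr; [intros; apply pow2_ge_0|lia].
    - replace ((M + e (S N)) * (M + e (S N))) with ((M + e (S N)) ^ 2) by ring.
      apply poly_coef_bound. intros z Hz. rewrite poly_scale.
      assert (Hrz : Cmod (r * z) <= r) by (apply Cmod_scale_lt; lra).
      specialize (Htail (S N) (r * z)%C ltac:(lia) Hrz).
      specialize (HM (r * z)%C). unfold inD in HM.
      assert (Ht := Cmod_triangle (f (r * z)%C) (poly a (S N) (r * z) - f (r * z)%C)).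
      replace (f (r * z) + (poly a (S N) (r * z) - f (r * z)))%C
        with (poly a (S N) (r * z)) in Ht by ring.
      lra. }
  (* The inequality becomes the sign of a real part so that the limit [r -> 1] can be taken with
     [Ccv_Re_ge0]. *)
  enough (H : 0 <= Re (RtoC (M ^ 2) + RtoC (-1) *
     csum (fun k => (a k * Cpow 1 k * Cconj (a k * Cpow 1 k))%C) (S n))).
  { rewrite (csum_ext _ (fun k => RtoC (Cmod (a k) ^ 2))), csum_RtoC in H.
    - rewrite Re_plus, !Re_scal, !re_RtoC in H. lra.
    - intros k _. rewrite Cpow_1_l, Cmod2_conj, Cmult_1_r. reflexivity. }
  apply Ccv_Re_ge0 with (u := fun m => (RtoC (M ^ 2) + RtoC (-1) *
     csum (fun k => (a k * Cpow (rad m) k * Cconj (a k * Cpow (rad m) k))%C) (S n))%C).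
  - exists O; intros m _. specialize (Hr m).
    rewrite (csum_ext _ (fun k => RtoC (Cmod (a k * RtoC (rad m ^ k)) ^ 2))), csum_RtoC.
    + rewrite Re_plus, !Re_scal, !re_RtoC. lra.
    + intros k _. rewrite Cmod2_conj, RtoC_pow. reflexivity.
  - apply Ccv_plus; [apply Ccv_const|]. apply Ccv_scal.
    apply (Ccv_csum (fun m k => (a k * Cpow (rad m) k * Cconj (a k * Cpow (rad m) k))%C)).
    intros k _.
    assert (H := Ccv_scal (a k) _ _ (Ccv_pow _ _ k rad_lim)).
    apply (Ccv_mult (fun m => (a k * Cpow (rad m) k)%C)); auto.
    apply (Ccv_conj (fun m => (a k * Cpow (rad m) k)%C)), H.
Qed.

(** * Positive semidefinite kernels *)

Definition quad (K : C -> C -> C) (c z : nat -> C) (n : nat) : C :=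
  csum (fun i => csum (fun j => (c i * Cconj (c j) * K (z i) (z j))%C) n) n.

(** Only the real part is constrained: Hermitian symmetry is a separate hypothesis where it is
    needed. The points may coincide, and all [z i] are taken in the disc to avoid index bounds. *)
Definition psd (K : C -> C -> C) : Prop :=
  forall n c z, (forall i, inD (z i)) -> 0 <= Re (quad K c z n).

Lemma quad_plus (K L : C -> C -> C) (c z : nat -> C) (n : nat) :
  quad (fun x y => (K x y + L x y)%C) c z n = (quad K c z n + quad L c z n)%C.
Proof.
  unfold quad. rewrite <- csum_plus. apply csum_ext; intros i _.
  rewrite <- csum_plus. apply csum_ext; intros; ring.
Qed.

Lemma quad_scal (a : C) (K : C -> C -> C) (c z : nat -> C) (n : nat) :
  quad (fun x y => (a * K x y)%C) c z n = (a * quad K c z n)%C.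
Proof.
  unfold quad. rewrite <- csum_scal. apply csum_ext; intros i _.
  rewrite <- csum_scal. apply csum_ext; intros; ring.
Qed.

Lemma quad_rank_one (u v : C -> C) (c z : nat -> C) (n : nat) :
  quad (fun x y => (u x * Cconj (v y))%C) c z n
    = (csum (fun i => c i * u (z i)) n * Cconj (csum (fun i => c i * v (z i)) n))%C.
Proof.
  unfold quad. rewrite csum_conj, Cmult_comm, <- csum_scal.
  apply csum_ext; intros i _.
  rewrite Cmult_comm, <- csum_scal. apply csum_ext; intros j _.
  rewrite Cmult_conj; ring.
Qed.

Lemma quad_ext (K L : C -> C -> C) (c z : nat -> C) (n : nat) :
  (forall i, inD (z i)) -> (forall x y, inD x -> inD y -> K x y = L x y) ->
  quad K c z n = quad L c z n.
Proof.
  intros Hz H. apply csum_ext; intros i _. apply csum_ext; intros j _. rewrite H; auto.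
Qed.

Lemma psd_ext (K L : C -> C -> C) :
  (forall x y, inD x -> inD y -> K x y = L x y) -> psd K -> psd L.
Proof.
  intros H HK n c z Hz. rewrite <- (quad_ext K L) by auto. now apply HK.
Qed.

Lemma psd_lim (Kn : nat -> C -> C -> C) (K : C -> C -> C) :
  (exists n0, forall n, (n0 <= n)%nat -> psd (Kn n)) ->
  (forall x y, inD x -> inD y -> Ccv (fun n => Kn n x y) (K x y)) -> psd K.
Proof.
  intros [n0 Hn] Hlim m c z Hz.
  apply Ccv_Re_ge0 with (u := fun n => quad (Kn n) c z m).
  - exists n0; intros n Hn'. now apply Hn.
  - unfold quad.
    apply (Ccv_csum (fun n i => csum (fun j => (c i * Cconj (c j) * Kn n (z i) (z j))%C) m)).
    intros i _.
    apply (Ccv_csum (fun n j => (c i * Cconj (c j) * Kn n (z i) (z j))%C)).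
    intros j _. apply Ccv_scal, Hlim; auto.
Qed.

(** Reduces positivity of an averaged kernel to positivity at each point [t] of the circle. *)
Lemma ravg_quad (N n : nat) (K : C -> C -> C -> C) (c z : nat -> C) :
  ravg N (fun t => quad (K t) c z n) = quad (fun x y => ravg N (fun t => K t x y)) c z n.
Proof.
  unfold quad.
  rewrite (ravg_csum N n (fun i t => csum (fun j => (c i * Cconj (c j) * K t (z i) (z j))%C) n)).
  apply csum_ext; intros i _.
  rewrite (ravg_csum N n (fun j t => (c i * Cconj (c j) * K t (z i) (z j))%C)).
  apply csum_ext; intros j _. apply ravg_scal.
Qed.

(* On the circle, [szego2 x y] is [k_x * conj k_y] with [k_x t = 1 / (1 - conj x * t)]. *)
Definition szego2 (x y t : C) : C := (/ ((1 - Cconj x * t) * (1 - y * Cconj t)))%C.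

Lemma ravg_poly_szego2 (a : nat -> C) (d : nat) (x y : C) :
  inD x -> inD y ->
  Ccv (fun N => ravg N (fun t => (poly a d t * szego2 x y t)%C))
      (poly a d y * / (1 - Cconj x * y))%C.
Proof.
  intros Hx Hy.
  apply Ccv_ext with (fun N => csum (fun k => (a k * ravg N (fun t => (Cpow t k * szego2 x y t)%C))%C) d).
  - exists O; intros N _.
    rewrite (csum_ext _ (fun k => ravg N (fun t => (a k * (Cpow t k * szego2 x y t))%C)))
      by (intros; symmetry; apply ravg_scal).
    rewrite <- ravg_csum. apply ravg_ext; intros t _. unfold poly.
    rewrite Cmult_comm, <- csum_scal. apply csum_ext; intros; ring.
  - apply Ccv_eq with (csum (fun k => (a k * (Cpow y k * / (1 - Cconj x * y)))%C) d).
    + unfold poly. rewrite (Cmult_comm (csum _ _)), <- csum_scal. apply csum_ext; intros; ring.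
    + apply (Ccv_csum (fun N k => (a k * ravg N (fun t => (Cpow t k * szego2 x y t)%C))%C)).
      intros k _. apply Ccv_scal. now apply ravg_two_kernels.
Qed.

Lemma szego2_conj (x y t : C) :
  inD x -> inD y -> Cmod t = 1 -> Cconj (szego2 x y t) = szego2 y x t.
Proof.
  intros Hx Hy Ht. unfold szego2.
  assert (H1 : (1 - Cconj x * t)%C <> 0).
  { apply C1_minus_neq_0, Cmod_mult_lt_1; rewrite ?Cmod_conj; try lra; auto. }
  assert (H2 : (1 - y * Cconj t)%C <> 0).
  { apply C1_minus_neq_0, Cmod_mult_lt_1; rewrite ?Cmod_conj; try lra; auto. }
  rewrite Cinv_conj by (now apply Cmult_neq_0).
  rewrite Cmult_conj, !Cminus_conj, !Cmult_conj, !Cconj_conj.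
  rewrite Cconj_1.
  f_equal. ring.
Qed.

(** * Pick's theorem *)

Lemma Re_le_Cmod (z : C) : Re z <= Cmod z.
Proof. assert (H := re_le_Cmod z). apply Rabs_le_between in H. lra. Qed.

(** The bound [M] is a parameter because the partial sums of a function bounded by [1] are bounded
    on a circle only by [1 + e n]. *)
Definition pick_kernel (M : R) (f : C -> C) (x y : C) : C :=
  ((RtoC (M ^ 2) - Cconj (f x) * f y) * / (1 - Cconj x * y))%C.

(* With [F = sum c_i k_(z_i)] and [G = sum c_i conj (p z_i) k_(z_i)], the form is
   [M^2 |F|^2 - 2 Re (p G conj F) + |G|^2 >= (M |F| - |G|)^2]. *)
Lemma circle_quad_ge0 (M : R) (p : C -> C) (t : C) (c z : nat -> C) (n : nat) :
  Cmod t = 1 -> (forall i, inD (z i)) -> Cmod (p t) <= M ->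
  0 <= Re (quad (fun x y =>
    (RtoC (M ^ 2) * szego2 x y t + (- Cconj (p x)) * (p t * szego2 x y t)
     + ((- p y) * Cconj (p t * szego2 y x t) + Cconj (p x) * p y * szego2 x y t))%C) c z n).
Proof.
  intros Ht Hz HM.
  set (u := fun x => (/ (1 - Cconj x * t))%C).
  assert (Hs : forall x y, inD x -> inD y -> szego2 x y t = (u x * Cconj (u y))%C).
  { intros x y Hx Hy. unfold szego2, u.
    assert (H1 : forall x, inD x -> (1 - Cconj x * t)%C <> 0).
    { intros; apply C1_minus_neq_0, Cmod_mult_lt_1; rewrite ?Cmod_conj; try lra; auto. }
    assert (H2 : (1 - y * Cconj t)%C <> 0).
    { apply C1_minus_neq_0, Cmod_mult_lt_1; rewrite ?Cmod_conj; try lra; auto. }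
    rewrite Cinv_conj, Cminus_conj, Cmult_conj, Cconj_conj by auto.
    rewrite Cconj_1.
    field. auto. }
  rewrite (quad_ext _ (fun x y =>
     ((RtoC (M ^ 2) * (u x * Cconj (u y))
      + (- p t) * ((Cconj (p x) * u x) * Cconj (u y)))
     + ((- Cconj (p t)) * (u x * Cconj (Cconj (p y) * u y))
        + (Cconj (p x) * u x) * Cconj (Cconj (p y) * u y)))%C)); auto.
  - rewrite !quad_plus, !quad_scal, !quad_rank_one.
    set (F := csum (fun i => (c i * u (z i))%C) n).
    set (G := csum (fun i => (c i * (Cconj (p (z i)) * u (z i)))%C) n).
    replace (- Cconj (p t) * (F * Cconj G))%C with (Cconj (- (p t * (G * Cconj F))))%C
      by (rewrite Copp_conj, !Cmult_conj, Cconj_conj; ring).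
    replace (- p t * (G * Cconj F))%C with (- (p t * (G * Cconj F)))%C by ring.
    rewrite <- !Cmod2_conj, !Re_plus, Re_scal, re_conj, !re_RtoC.
    assert (H := Re_le_Cmod (p t * (G * Cconj F))).
    rewrite !Cmod_mult, Cmod_conj in H.
    replace (Re (- (p t * (G * Cconj F)))) with (- Re (p t * (G * Cconj F))) by reflexivity.
    assert (HF := Cmod_ge_0 F). assert (HG := Cmod_ge_0 G).
    assert (0 <= (M - Cmod (p t)) * (Cmod G * Cmod F)) by (apply Rmult_le_pos; nra).
    assert (0 <= (M * Cmod F - Cmod G) ^ 2) by apply pow2_ge_0.
    nra.
  - intros x y Hx Hy. rewrite Cmult_conj, szego2_conj by auto.
    rewrite !Hs by auto. rewrite Cmult_conj, Cconj_conj. ring.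
Qed.

Lemma pick_poly (a : nat -> C) (d : nat) (M : R) :
  (forall t, Cmod t = 1 -> Cmod (poly a d t) <= M) -> psd (pick_kernel M (poly a d)).
Proof.
  intros HM. set (p := poly a d).
  apply psd_lim with (Kn := fun N x y => ravg N (fun t =>
    (RtoC (M ^ 2) * szego2 x y t + (- Cconj (p x)) * (p t * szego2 x y t)
     + ((- p y) * Cconj (p t * szego2 y x t) + Cconj (p x) * p y * szego2 x y t))%C)).
  - exists O; intros N _ n c z Hz. rewrite <- (ravg_quad N n (fun t x y =>
      (RtoC (M ^ 2) * szego2 x y t + (- Cconj (p x)) * (p t * szego2 x y t)
     + ((- p y) * Cconj (p t * szego2 y x t) + Cconj (p x) * p y * szego2 x y t))%C)).
    apply ravg_Re_ge0. intros t Ht. apply (circle_quad_ge0 M p t c z n); auto.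
  - intros x y Hx Hy.
    assert (H0 : forall x y, inD x -> inD y ->
       Ccv (fun N => ravg N (szego2 x y)) (/ (1 - Cconj x * y))%C).
    { intros v w Hv Hw.
      apply Ccv_eq with (poly (fun _ => RtoC 1) 1 w * / (1 - Cconj v * w))%C;
        [unfold poly; simpl; ring|].
      apply Ccv_ext with (fun N => ravg N (fun t => (poly (fun _ => RtoC 1) 1 t * szego2 v w t)%C)).
      - exists O; intros; apply ravg_ext; intros; unfold poly; simpl; ring.
      - now apply ravg_poly_szego2. }
    apply Ccv_ext with (fun N =>
      (RtoC (M ^ 2) * ravg N (szego2 x y)
       + (- Cconj (p x)) * ravg N (fun t => (p t * szego2 x y t)%C)
       + ((- p y) * Cconj (ravg N (fun t => (p t * szego2 y x t)%C))
          + Cconj (p x) * p y * ravg N (szego2 x y)))%C).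
    + exists O; intros N _. rewrite <- ravg_conj, <- !ravg_scal, <- !ravg_plus. reflexivity.
    (* By the reproducing property both cross terms tend to minus the last term,
       [conj (p x) * p y / (1 - conj x * y)]; one cancels it and the other gives the Pick kernel. *)
    + apply Ccv_eq with
       (RtoC (M ^ 2) * / (1 - Cconj x * y) + (- Cconj (p x)) * (p y * / (1 - Cconj x * y))
        + ((- p y) * Cconj (p x * / (1 - Cconj y * x))
           + Cconj (p x) * p y * / (1 - Cconj x * y)))%C.
      * unfold pick_kernel. rewrite Cmult_conj, Cinv_conj, Cminus_conj, Cmult_conj, Cconj_conj.
        -- rewrite Cconj_1.
           rewrite (Cmult_comm y (Cconj x)). ring.
        -- apply C1_minus_neq_0, Cmod_mult_lt_1; rewrite ?Cmod_conj; auto; apply Rlt_le, Hx.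
      * repeat apply Ccv_plus; apply Ccv_scal; auto.
        -- now apply ravg_poly_szego2.
        -- apply Ccv_conj. now apply ravg_poly_szego2.
Qed.

Lemma holo_Ccv (f : C -> C) (u : nat -> C) (x : C) :
  holo_on_D f -> inD x -> Ccv u x -> Ccv (fun n => f (u n)) (f x).
Proof.
  intros Hf Hx Hu. destruct (Hf x Hx) as [l Hl].
  assert (Hc := ex_derive_continuous (K := C_AbsRing) (V := C_NormedModule) f x
    (ex_intro _ l Hl)).
  apply Ccv_filterlim. apply Ccv_filterlim in Hu.
  intros P HP. specialize (Hc P HP). apply locally_C in Hc. exact (Hu _ Hc).
Qed.

(** Positivity passes to the limit twice: along the partial sums at a fixed radius, then along the
    radii by continuity of [f]. *)
Lemma pick_coef (a : nat -> C) (f : C -> C) :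
  is_coef a f -> holo_on_D f -> (forall z, inD z -> Cmod (f z) <= 1) ->
  psd (pick_kernel 1 f).
Proof.
  intros Ha Hf H1.
  apply psd_lim with (Kn := fun m => pick_kernel 1 (fun z => f (rad m * z)%C)).
  - exists O; intros m _. assert (Hb := rad_bound m). set (r := rad m) in *.
    destruct (coef_tail a f r Ha Hb) as (e & n0 & He & Htail).
    apply psd_lim with (Kn := fun n =>
       pick_kernel (1 + e n) (poly (fun k => (a k * RtoC (r ^ k))%C) n)).
    + exists n0; intros n Hn. apply pick_poly. intros t Ht. rewrite poly_scale.
      assert (Hrz : Cmod (r * t) <= r) by (apply Cmod_scale_lt; lra).
      specialize (Htail n (r * t)%C Hn Hrz).
      specialize (H1 (r * t)%C). unfold inD in H1.
      assert (Ht' := Cmod_triangle (f (r * t)%C) (poly a n (r * t) - f (r * t)%C)).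
      replace (f (r * t) + (poly a n (r * t) - f (r * t)))%C
        with (poly a n (r * t)) in Ht' by ring.
      lra.
    + assert (Hp : forall z, inD z ->
        Ccv (fun n => poly (fun k => (a k * RtoC (r ^ k))%C) n z) (f (r * z)%C)).
      { intros z Hz. apply Ccv_ext with (fun n => poly a n (r * z)).
        - exists O; intros; now rewrite poly_scale.
        - apply is_coef_Ccv; auto. unfold inD in *.
          apply Rle_lt_trans with r; [apply Cmod_scale_lt|]; lra. }
      intros x y Hx Hy. unfold pick_kernel. apply Ccv_mult; [|apply Ccv_const].
      apply Ccv_ext with (fun n => (RtoC ((1 + e n) ^ 2) + - (1) *
         (Cconj (poly (fun k => (a k * RtoC (r ^ k))%C) n x)
           * poly (fun k => (a k * RtoC (r ^ k))%C) n y))%C).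
      * exists O; intros; ring.
      * replace (RtoC (1 ^ 2) - Cconj (f (r * x)%C) * f (r * y)%C)%C with
         (RtoC (1 ^ 2) + - (1) * (Cconj (f (r * x)%C) * f (r * y)%C))%C by ring.
        apply Ccv_plus.
        -- assert (He2 : is_lim_seq (fun n => (1 + e n) * (1 + e n) - 1) ((1 + 0) * (1 + 0) - 1)).
           { apply is_lim_seq_minus'; [|apply is_lim_seq_const].
             apply is_lim_seq_mult'; apply is_lim_seq_plus'; auto using is_lim_seq_const. }
           replace ((1 + 0) * (1 + 0) - 1) with 0 in He2 by ring.
           apply is_lim_seq_abs in He2. simpl in He2. rewrite Rabs_R0 in He2.
           apply Ccv_bound with (2 := He2). exists O; intros n _.
           rewrite <- RtoC_minus, Cmod_R. apply Req_le. f_equal. ring.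
        -- apply Ccv_scal, Ccv_mult; auto. now apply Ccv_conj, Hp.
  - assert (Hp : forall z, inD z -> Ccv (fun m => f (rad m * z)%C) (f z)).
    { intros z Hz. apply holo_Ccv; auto.
      apply Ccv_eq with (1 * z)%C; [ring|].
      apply (Ccv_mult (fun m => RtoC (rad m)) (fun _ => z)); auto using rad_lim, Ccv_const. }
    intros x y Hx Hy. unfold pick_kernel. apply Ccv_mult; [|apply Ccv_const].
    apply Ccv_ext with (fun m => (RtoC (1 ^ 2) + - (1) *
         (Cconj (f (rad m * x)%C) * f (rad m * y)%C))%C).
    + exists O; intros; ring.
    + replace (RtoC (1 ^ 2) - Cconj (f x) * f y)%C with
         (RtoC (1 ^ 2) + - (1) * (Cconj (f x) * f y))%C by ring.
      apply Ccv_plus; [apply Ccv_const|].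
      apply Ccv_scal, Ccv_mult; auto. now apply Ccv_conj, Hp.
Qed.

(** A Schur complement: [p] is added as an extra point, with the coefficient [- A] that minimizes
    the form and lowers its value by [|A|^2]. *)
Lemma psd_schur (K : C -> C -> C) (p : C) :
  inD p -> K p p = 1 -> (forall x y, inD x -> inD y -> K y x = Cconj (K x y)) -> psd K ->
  psd (fun x y => (K x y - K x p * K p y)%C).
Proof.
  intros Hp Hpp Hsym HK n c z Hz.
  set (A := csum (fun i => (c i * K (z i) p)%C) n).
  set (c' := fun i => if Nat.eqb i n then (- A)%C else c i).
  set (z' := fun i => if Nat.eqb i n then p else z i).
  assert (Hz' : forall i, inD (z' i)) by (intros i; unfold z'; destruct (Nat.eqb i n); auto).
  assert (Hc'n : c' n = (- A)%C) by (unfold c'; now rewrite Nat.eqb_refl).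
  assert (Hz'n : z' n = p) by (unfold z'; now rewrite Nat.eqb_refl).
  assert (Hlt : forall i, (i < n)%nat -> c' i = c i /\ z' i = z i).
  { intros i Hi. unfold c', z'. replace (Nat.eqb i n) with false; auto.
    symmetry; apply Nat.eqb_neq; lia. }
  assert (E : quad K c' z' (S n)
     = quad (fun x y => (K x y - K x p * K p y)%C) c z n).
  { assert (E0 : quad K c' z' (S n) = (quad K c z n - A * Cconj A)%C).
    { unfold quad at 1.
      change (csum ?u (S n)) with (csum u n + u n)%C. cbv beta.
      rewrite (csum_ext (fun i => csum _ (S n))
        (fun i => (csum (fun j => c i * Cconj (c j) * K (z i) (z j)) n
                  + (- Cconj A) * (c i * K (z i) p))%C)).
      2:{ intros i Hi. change (csum ?u (S n)) with (csum u n + u n)%C. cbv beta.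
          destruct (Hlt i Hi) as [-> ->]. rewrite Hc'n, Hz'n, Copp_conj. f_equal; [|ring].
          apply csum_ext; intros j Hj. now destruct (Hlt j Hj) as [-> ->]. }
      rewrite csum_plus, csum_scal. fold A. fold (quad K c z n).
      change (csum ?u (S n)) with (csum u n + u n)%C. cbv beta.
      rewrite (csum_ext _ (fun j => (- A) * Cconj (c j * K (z j) p))%C).
      2:{ intros j Hj. destruct (Hlt j Hj) as [-> ->].
          rewrite Hc'n, Hz'n, (Hsym (z j) p) by auto. rewrite Cmult_conj. ring. }
      rewrite csum_scal, <- csum_conj. fold A.
      rewrite Hc'n, Hz'n, Hpp, Copp_conj. ring. }
    rewrite E0.
    rewrite (quad_ext (fun x y => (K x y - K x p * K p y)%C)
       (fun x y => (K x y + - (1) * (K x p * Cconj (K y p)))%C)); auto.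
    - rewrite quad_plus, quad_scal, (quad_rank_one (fun x => K x p) (fun x => K x p)).
      fold A. ring.
    - intros x y Hx Hy. rewrite (Hsym y p) by auto. ring. }
  rewrite <- E. now apply HK.
Qed.

Lemma psd_two_points (K : C -> C -> C) (x y : C) (p q : R) :
  psd K -> inD x -> inD y -> K x x = RtoC p -> K y y = RtoC q -> K y x = Cconj (K x y) ->
  0 <= p /\ 0 <= q /\ Cmod (K x y) ^ 2 <= p * q.
Proof.
  intros HK Hx Hy Hxx Hyy Hyx.
  assert (H : forall a b : C,
    0 <= Cmod a ^ 2 * p + Cmod b ^ 2 * q + 2 * Re (a * Cconj b * K x y)).
  { intros a b.
    assert (Hz : forall i, inD ((fun i => if Nat.eqb i 0 then x else y) i))
      by (intros i; simpl; destruct (Nat.eqb i 0); auto).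
    assert (H := HK 2%nat (fun i => if Nat.eqb i 0 then a else b) _ Hz).
    unfold quad in H. cbn [csum Nat.eqb] in H. rewrite Hxx, Hyy, Hyx in H.
    replace (0 + (0 + a * Cconj a * p + a * Cconj b * K x y) +
      (0 + b * Cconj a * Cconj (K x y) + b * Cconj b * q))%C with
      (p * (a * Cconj a) + q * (b * Cconj b)
       + (a * Cconj b * K x y + Cconj (a * Cconj b * K x y)))%C in H
      by (rewrite !Cmult_conj, Cconj_conj; ring).
    rewrite <- !Cmod2_conj, !Re_plus, !Re_scal, re_conj, !re_RtoC in H. lra. }
  assert (Hp := H 1 0). assert (Hq := H 0 1).
  rewrite Cmod_1, Cmod_0 in Hp, Hq.
  replace (1 * Cconj 0 * K x y)%C with (RtoC 0) in Hp by (apply injective_projections; simpl; ring).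
  replace (0 * Cconj 1 * K x y)%C with (RtoC 0) in Hq by (apply injective_projections; simpl; ring).
  rewrite re_RtoC in Hp, Hq.
  assert (Hp0 : 0 <= p) by lra. assert (Hq0 : 0 <= q) by lra.
  repeat split; auto.
  (* Matching the phase of the coefficients to [K x y] leaves a real quadratic in [s]. *)
  assert (H2 : forall s : R, 0 <= Cmod (K x y) ^ 2 * p - 2 * s * Cmod (K x y) ^ 2 + s ^ 2 * q).
  { intros s. specialize (H (Cconj (K x y)) (- s)%R).
    rewrite Cmod_conj, Cmod_R, pow2_abs in H.
    replace (Cconj (K x y) * Cconj (- s)%R * K x y)%C
      with (RtoC (- s) * RtoC (Cmod (K x y) ^ 2))%C in H.
    - rewrite Re_scal, re_RtoC in H. nra.
    - rewrite Cmod2_conj. replace (Cconj (- s)%R) with (RtoC (- s))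
        by (apply injective_projections; simpl; ring). ring. }
  set (k2 := Cmod (K x y) ^ 2) in *. assert (Hk : 0 <= k2) by apply pow2_ge_0.
  destruct (Rle_lt_or_eq_dec 0 q Hq0) as [Hq1|Hq1].
  (* The minimizer of this quadratic. *)
  - specialize (H2 (k2 / q)).
    replace (k2 * p - 2 * (k2 / q) * k2 + (k2 / q) ^ 2 * q)
      with (k2 * (p * q - k2) / q) in H2 by (field; lra).
    destruct (Rle_lt_dec k2 (p * q)) as [|Hlt]; auto.
    exfalso. assert (k2 * (p * q - k2) / q < 0); [|lra].
    assert (0 < / q) by (apply Rinv_0_lt_compat; lra).
    assert (Hpq : 0 <= p * q) by nra.
    assert (Hneg : k2 * (p * q - k2) < 0) by nra.
    unfold Rdiv. nra.
  (* For [q = 0] the expression is [k2 * (p - 2 s)]; at [s = p + 1] the second factor is negative,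
     so [k2 = 0]. *)
  - subst q. specialize (H2 (p + 1)). nra.
Qed.

(** * Fixed points from bounded orbits *)

(* [cosh] of the hyperbolic distance. *)
Definition dch (z w : C) : R :=
  2 * Cmod (1 - Cconj z * w) ^ 2 / ((1 - Cmod z ^ 2) * (1 - Cmod w ^ 2)) - 1.

Lemma inD_sq (z : C) : inD z -> 0 < 1 - Cmod z ^ 2.
Proof. unfold inD; intros H. assert (H0 := Cmod_ge_0 z). nra. Qed.

Lemma inD_sq_inv (z : C) : 0 < 1 - Cmod z ^ 2 -> inD z.
Proof. unfold inD; intros H. assert (H0 := Cmod_ge_0 z). nra. Qed.

Lemma one_minus_conj_neq_0 (x y : C) : inD x -> inD y -> (1 - Cconj x * y)%C <> 0.
Proof.
  intros Hx Hy. apply C1_minus_neq_0, Cmod_mult_lt_1; rewrite ?Cmod_conj; auto.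
  now apply Rlt_le.
Qed.

Lemma dch_minus_1 (z w : C) :
  inD z -> inD w ->
  dch z w - 1 = 2 * Cmod (z - w) ^ 2 / ((1 - Cmod z ^ 2) * (1 - Cmod w ^ 2)).
Proof.
  intros Hz Hw. apply inD_sq in Hz, Hw. unfold dch.
  assert (E : Cmod (1 - Cconj z * w) ^ 2
    = Cmod (z - w) ^ 2 + (1 - Cmod z ^ 2) * (1 - Cmod w ^ 2)).
  { rewrite !Cmod2_alt. unfold Re, Im. simpl. ring. }
  rewrite E. field. lra.
Qed.

(** Turns hyperbolic closeness into Euclidean closeness, for which completeness is available. *)
Lemma Cmod_sq_le_dch (z w : C) : inD z -> inD w -> Cmod (z - w) ^ 2 <= (dch z w - 1) / 2.
Proof.
  intros Hz Hw. rewrite dch_minus_1 by auto. apply inD_sq in Hz, Hw.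
  assert (H0 := pow2_ge_0 (Cmod (z - w))).
  assert (Hz1 := pow2_ge_0 (Cmod z)). assert (Hw1 := pow2_ge_0 (Cmod w)).
  set (d := (1 - Cmod z ^ 2) * (1 - Cmod w ^ 2)).
  assert (Hd : 0 < d <= 1) by (unfold d; split; nra).
  replace (2 * Cmod (z - w) ^ 2 / d / 2) with (Cmod (z - w) ^ 2 * / d) by (field; lra).
  assert (/ 1 <= / d) by (apply Rinv_le_contravar; lra). rewrite Rinv_1 in *. nra.
Qed.

Lemma dch_ge_1 (z w : C) : inD z -> inD w -> 1 <= dch z w.
Proof.
  intros Hz Hw. assert (H := Cmod_sq_le_dch z w Hz Hw).
  assert (H0 := pow2_ge_0 (Cmod (z - w))). lra.
Qed.

(** Points at bounded hyperbolic distance from [|w| <= r] stay away from the circle: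
    [|1 - conj z w| >= 1 - r] while [1 - |z|^2] sits in the denominator of [dch]. This keeps limits
    inside the disc. *)
Lemma dch_coercive (z w : C) (r c : R) :
  inD z -> Cmod w <= r -> r < 1 -> dch z w <= c -> 2 * (1 - r) ^ 2 <= (c + 1) * (1 - Cmod z ^ 2).
Proof.
  intros Hz Hw Hr Hc.
  assert (Hw' : inD w) by (unfold inD; lra).
  assert (Hz2 := inD_sq z Hz). assert (Hw2 := inD_sq w Hw').
  assert (Hm : 1 - r <= Cmod (1 - Cconj z * w)).
  { assert (Ht := Cmod_triangle (1 - Cconj z * w) (Cconj z * w)).
    replace (1 - Cconj z * w + Cconj z * w)%C with (RtoC 1) in Ht by ring.
    rewrite Cmod_1, Cmod_mult, Cmod_conj in Ht. unfold inD in Hz.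
    assert (H0 := Cmod_ge_0 z). assert (H1 := Cmod_ge_0 w). nra. }
  assert (Hm2 : (1 - r) ^ 2 <= Cmod (1 - Cconj z * w) ^ 2) by (apply pow_incr; lra).
  unfold dch in Hc.
  set (A := Cmod (1 - Cconj z * w) ^ 2) in *. set (u := 1 - Cmod z ^ 2) in *.
  set (v := 1 - Cmod w ^ 2) in *.
  assert (Hv : v <= 1) by (unfold v; assert (H := pow2_ge_0 (Cmod w)); lra).
  assert (E : 2 * A = (2 * A / (u * v)) * (u * v)) by (field; lra).
  assert (0 <= 2 * A / (u * v)).
  { apply Rdiv_le_0_compat; [|nra]. assert (H := pow2_ge_0 (1 - r)). lra. }
  set (q := 2 * A / (u * v)) in *.
  assert (q * (u * v) <= (c + 1) * u); [|lra].
  assert (0 <= q * u) by nra. nra.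
Qed.

(* Coordinates on the hyperboloid [x0^2 - x1^2 - x2^2 = 1], where [dch] is the Lorentz
   form and midpoints are normalized sums. *)
Definition lor0 (z : C) : R := (1 + Cmod z ^ 2) / (1 - Cmod z ^ 2).
Definition lor1 (z : C) : R := 2 * Re z / (1 - Cmod z ^ 2).
Definition lor2 (z : C) : R := 2 * Im z / (1 - Cmod z ^ 2).

Lemma dch_lorentz (z w : C) :
  inD z -> inD w ->
  dch z w = lor0 z * lor0 w - lor1 z * lor1 w - lor2 z * lor2 w.
Proof.
  intros Hz Hw. apply inD_sq in Hz, Hw. unfold dch, lor0, lor1, lor2.
  rewrite !Cmod2_alt in *. destruct z as [a b], w as [c d]. unfold Re, Im in *; simpl fst in *; simpl snd in *.
  field. split; lra.
Qed.

Lemma lor_norm (z : C) : inD z -> lor0 z ^ 2 - lor1 z ^ 2 - lor2 z ^ 2 = 1 /\ 1 <= lor0 z.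
Proof.
  intros Hz. apply inD_sq in Hz. unfold lor0, lor1, lor2. split.
  - rewrite Cmod2_alt in *. field. lra.
  - apply Rle_div_r; auto. assert (H := pow2_ge_0 (Cmod z)). lra.
Qed.

(** Stereographic projection of the upper sheet from the point [(-1, 0, 0)]. *)
Lemma lor_surj (m0 m1 m2 : R) :
  m0 ^ 2 - m1 ^ 2 - m2 ^ 2 = 1 -> 0 < m0 ->
  exists m, inD m /\ lor0 m = m0 /\ lor1 m = m1 /\ lor2 m = m2.
Proof.
  intros H Hm. set (m := (m1 / (1 + m0), m2 / (1 + m0)) : C). exists m.
  assert (E : Cmod m ^ 2 = (m0 - 1) / (1 + m0)).
  { rewrite Cmod2_alt. unfold m, Re, Im; simpl fst; simpl snd.
    replace ((m1 / (1 + m0)) ^ 2 + (m2 / (1 + m0)) ^ 2)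
      with ((m1 ^ 2 + m2 ^ 2) / (1 + m0) ^ 2) by (field; lra).
    replace (m1 ^ 2 + m2 ^ 2) with ((m0 - 1) * (1 + m0)) by nra. field. lra. }
  assert (E1 : 1 - Cmod m ^ 2 = 2 / (1 + m0)) by (rewrite E; field; lra).
  split; [|unfold lor0, lor1, lor2; rewrite E1, ?E; unfold m, Re, Im; simpl fst; simpl snd;
           repeat split; field; lra].
  apply inD_sq_inv. rewrite E1. apply Rdiv_lt_0_compat; lra.
Qed.

(** The sum of two points of the hyperboloid has Lorentz square [2 + 2 * dch x y]. The identity, by
    bilinearity valid for every [w], is the uniform convexity needed below: the farther [x] is from
    [y], the more the midpoint gains. *)
Lemma dch_midpoint (x y : C) :
  inD x -> inD y ->
  exists m, inD m /\ forall w, inD w ->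
    dch m w = (dch x w + dch y w) / sqrt (2 + 2 * dch x y).
Proof.
  intros Hx Hy.
  destruct (lor_norm x Hx) as [Nx Px]. destruct (lor_norm y Hy) as [Ny Py].
  assert (Hd := dch_ge_1 x y Hx Hy).
  set (s := sqrt (2 + 2 * dch x y)).
  assert (Hs : 0 < s) by (apply sqrt_lt_R0; lra).
  assert (Hs2 : s ^ 2 = 2 + 2 * dch x y) by (apply pow2_sqrt; lra).
  destruct (lor_surj ((lor0 x + lor0 y) / s) ((lor1 x + lor1 y) / s) ((lor2 x + lor2 y) / s))
    as (m & Hm & E0 & E1 & E2).
  - rewrite dch_lorentz in Hs2 by auto.
    replace (((lor0 x + lor0 y) / s) ^ 2 - ((lor1 x + lor1 y) / s) ^ 2 - ((lor2 x + lor2 y) / s) ^ 2)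
      with (((lor0 x + lor0 y) ^ 2 - (lor1 x + lor1 y) ^ 2 - (lor2 x + lor2 y) ^ 2) / s ^ 2)
      by (field; lra).
    apply Rmult_eq_reg_r with (s ^ 2); [|nra]. unfold Rdiv. rewrite Rmult_assoc, Rinv_l by nra.
    rewrite Hs2. nra.
  - apply Rdiv_lt_0_compat; lra.
  - exists m; split; auto. intros w Hw. rewrite !dch_lorentz by auto.
    rewrite E0, E1, E2. field. lra.
Qed.

(** * Asymptotic centre of a bounded orbit *)

Lemma Cmod_le_abs_sum (z : C) : Cmod z <= Rabs (Re z) + Rabs (Im z).
Proof.
  assert (H := Cmod_triangle (RtoC (Re z)) (Ci * RtoC (Im z))).
  rewrite Cmod_mult, !Cmod_R in H.
  assert (E : Cmod Ci = 1) by apply Cmod_Ci. rewrite E in H.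
  replace (RtoC (Re z) + Ci * RtoC (Im z))%C with z in H; [lra|].
  apply injective_projections; unfold Re, Im; simpl; ring.
Qed.

Lemma Im_le_Cmod (z : C) : Rabs (Im z) <= Cmod z.
Proof. eapply Rle_trans; [apply Rmax_r|apply Rmax_Cmod]. Qed.

Lemma C_cauchy_complete (u : nat -> C) :
  (forall eps : posreal, exists N, forall n m, (N <= n)%nat -> (N <= m)%nat ->
     Cmod (u n - u m) < eps) ->
  exists l, Ccv u l.
Proof.
  intros H.
  assert (H1 : ex_finite_lim_seq (fun n => Re (u n))).
  { apply ex_lim_seq_cauchy_corr. intros eps. destruct (H eps) as [N HN].
    exists N; intros n m Hn Hm. specialize (HN n m Hn Hm).
    eapply Rle_lt_trans; [|exact HN]. exact (re_le_Cmod (u n - u m)). }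
  assert (H2 : ex_finite_lim_seq (fun n => Im (u n))).
  { apply ex_lim_seq_cauchy_corr. intros eps. destruct (H eps) as [N HN].
    exists N; intros n m Hn Hm. specialize (HN n m Hn Hm).
    eapply Rle_lt_trans; [|exact HN]. exact (Im_le_Cmod (u n - u m)). }
  destruct H1 as [a Ha], H2 as [b Hb]. exists (a, b).
  apply Ccv_bound with (fun n => Rabs (Re (u n) - a) + Rabs (Im (u n) - b)).
  - exists O; intros n _. apply (Cmod_le_abs_sum (u n - (a, b))).
  - assert (H0 : forall v (l : R), is_lim_seq v l -> is_lim_seq (fun n => Rabs (v n - l)) 0).
    { intros v l Hv. rewrite <- (Rabs_R0), <- (Rminus_diag l).
      apply (is_lim_seq_abs _ (Finite (l - l))).
      apply is_lim_seq_minus'; auto using is_lim_seq_const. }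
    rewrite <- (Rplus_0_r 0). apply is_lim_seq_plus'; auto.
Qed.

Lemma inf_exists (E : R -> Prop) (m : R) :
  (exists x, E x) -> (forall x, E x -> m <= x) ->
  exists I, m <= I /\ (forall x, E x -> I <= x) /\
    forall eps, 0 < eps -> exists x, E x /\ x < I + eps.
Proof.
  intros [x0 Hx0] Hm.
  destruct (completeness (fun y => E (- y))) as [s [Hub Hleast]].
  - exists (- m). intros y Hy. specialize (Hm _ Hy). lra.
  - exists (- x0). now rewrite Ropp_involutive.
  - exists (- s). repeat split.
    + assert (s <= - m); [|lra]. apply Hleast. intros y Hy. specialize (Hm _ Hy). lra.
    + intros x Hx. assert (- x <= s); [|lra]. apply Hub. now rewrite Ropp_involutive.
    + intros eps Heps. apply NNPP; intros Hn.
      assert (s <= s - eps); [|lra]. apply Hleast. intros y Hy.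
      destruct (Rle_lt_dec y (s - eps)); auto. exfalso; apply Hn. exists (- y). split; auto. lra.
Qed.

Lemma iter_inD (f : C -> C) (z : C) (n : nat) :
  (forall z, inD z -> inD (f z)) -> inD z -> inD (Nat.iter n f z).
Proof. intros Hf Hz. induction n as [|n IH]; simpl; auto. Qed.

(* The asymptotic centre of the orbit: near-minimizers of
   [x |-> limsup (dch x (z_n))] are close to each other (midpoints), and [f] maps
   near-minimizers to near-minimizers. *)
Lemma bounded_orbit_fixed_point (f : C -> C) (z0 : C) (r : R) :
  (forall z, inD z -> inD (f z)) ->
  (forall x y, inD x -> inD y -> dch (f x) (f y) <= dch x y) ->
  (forall u x, inD x -> Ccv u x -> Ccv (fun n => f (u n)) (f x)) ->
  inD z0 -> r < 1 -> (forall n, Cmod (Nat.iter n f z0) <= r) ->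
  exists x, inD x /\ f x = x.
Proof.
  intros Hf Hne Hcont Hz0 Hr Horb.
  set (zn := fun n => Nat.iter n f z0) in *.
  assert (Hzn : forall n, inD (zn n)) by (intros; now apply iter_inD).
  (* An upper bound holding eventually replaces the limsup; the infimum [I] of such [c] over all [x]
     is the asymptotic radius. *)
  set (B := fun x c => inD x /\ exists n0, forall n, (n0 <= n)%nat -> dch x (zn n) <= c).
  assert (HBf : forall x c, B x c -> B (f x) c).
  { intros x c [Hx [n0 Hn0]]. split; auto. exists (S n0). intros n Hn.
    destruct n as [|n]; [lia|]. eapply Rle_trans; [apply Hne; auto|]. apply Hn0; lia. }
  destruct (inf_exists (fun c => exists x, B x c) 1) as (I & HI1 & HIle & HIeps).
  (* The origin is a candidate centre, since [dch 0 w = 2 / (1 - |w|^2) - 1]. *)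
  { exists (2 / (1 - r ^ 2) - 1), 0. split; [unfold inD; rewrite Cmod_0; lra|].
    exists O; intros n _. unfold dch.
    replace (1 - Cconj 0 * zn n)%C with (RtoC 1) by (apply injective_projections; simpl; ring).
    rewrite Cmod_0, Cmod_1. specialize (Horb n). fold (zn n) in Horb.
    assert (H0 := Cmod_ge_0 (zn n)).
    assert (Hr2 : Cmod (zn n) ^ 2 <= r ^ 2) by (apply pow_incr; lra).
    assert (r ^ 2 < 1) by nra.
    assert (/ (1 - Cmod (zn n) ^ 2) <= / (1 - r ^ 2)) by (apply Rinv_le_contravar; lra).
    replace ((1 - 0 ^ 2) * (1 - Cmod (zn n) ^ 2)) with (1 - Cmod (zn n) ^ 2) by ring.
    unfold Rdiv. lra. }
  { intros c (x & Hx & n0 & Hn0). eapply Rle_trans; [|exact (Hn0 n0 (le_n _))].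
    now apply dch_ge_1. }
  assert (Hclose : forall x y d, B x (I + d) -> B y (I + d) ->
            Cmod (x - y) ^ 2 <= 2 * I * d + d ^ 2).
  { intros x y d [Hx [n0 Hn0]] [Hy [n1 Hn1]].
    destruct (dch_midpoint x y Hx Hy) as (m & Hm & Hmid).
    assert (Hd1 := dch_ge_1 x y Hx Hy).
    set (s := sqrt (2 + 2 * dch x y)) in *.
    assert (Hs : 0 < s) by (apply sqrt_lt_R0; lra).
    assert (Hs2 : s ^ 2 = 2 + 2 * dch x y) by (apply pow2_sqrt; lra).
    (* The midpoint cannot do better than the infimum, which bounds [s] and hence [dch x y]; as
       [I >= 1], the factor [I^2] can then be dropped. *)
    assert (HIs : I <= 2 * (I + d) / s).
    { apply HIle. exists m. split; auto. exists (n0 + n1)%nat; intros n Hn.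
      rewrite Hmid by auto. apply Rmult_le_compat_r; [apply Rlt_le, Rinv_0_lt_compat; lra|].
      specialize (Hn0 n ltac:(lia)). specialize (Hn1 n ltac:(lia)). lra. }
    apply Rle_div_r in HIs; auto.
    assert (H2 : (I * s) ^ 2 <= (2 * (I + d)) ^ 2) by (apply pow_incr; nra).
    rewrite Rpow_mult_distr, Hs2 in H2.
    assert (H3 := Cmod_sq_le_dch x y Hx Hy).
    assert (0 <= (I ^ 2 - 1) * (dch x y - 1)) by (apply Rmult_le_pos; nra).
    lra. }
  assert (Hdpos : forall k, 0 < / (INR k + 1)).
  { intros k. apply Rinv_0_lt_compat. assert (H := pos_INR k). lra. }
  assert (Hchoice : forall k : nat, {x | B x (I + / (INR k + 1))}).
  { intros k. apply constructive_indefinite_description.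
    destruct (HIeps _ (Hdpos k)) as (c & [x [Hx [n0 Hn0]]] & Hc).
    exists x. split; auto. exists n0; intros n Hn. specialize (Hn0 n Hn). lra. }
  set (x := fun k => proj1_sig (Hchoice k)).
  assert (Hx : forall k, B (x k) (I + / (INR k + 1))) by (intros k; apply (proj2_sig (Hchoice k))).
  assert (Hmono : forall j k y, (j <= k)%nat -> B y (I + / (INR k + 1)) -> B y (I + / (INR j + 1))).
  { intros j k y Hjk [Hy [n0 Hn0]]. split; auto. exists n0; intros n Hn. specialize (Hn0 n Hn).
    apply le_INR in Hjk. assert (H := pos_INR j).
    assert (/ (INR k + 1) <= / (INR j + 1)) by (apply Rinv_le_contravar; lra). lra. }
  (* The bound of [Hclose] for [d = 1 / (k + 1)]. *)
  set (g := fun k => 2 * I * / (INR k + 1) + (/ (INR k + 1)) ^ 2).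
  assert (Hd0 : is_lim_seq (fun k => / (INR k + 1)) 0).
  { apply (is_lim_seq_inv (fun k => INR k + 1) p_infty); [|discriminate].
    eapply is_lim_seq_ext; [|exact (proj1 (is_lim_seq_incr_1 INR _) is_lim_seq_INR)].
    intros n. cbv beta. now rewrite S_INR. }
  assert (Hg : is_lim_seq g 0).
  { replace (Finite 0) with (Finite (2 * I * 0 + 0 * (0 * 1))) by (f_equal; ring).
    apply is_lim_seq_plus'; repeat apply is_lim_seq_mult'; auto using is_lim_seq_const. }
  assert (Hsqrtg : is_lim_seq (fun k => sqrt (g k)) 0).
  { rewrite <- sqrt_0. apply (is_lim_seq_continuous sqrt); auto.
    apply continuity_pt_filterlim, continuous_sqrt. }
  assert (Hle : forall y z k, B y (I + / (INR k + 1)) -> B z (I + / (INR k + 1)) ->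
             Cmod (y - z) <= sqrt (g k)).
  { intros y z k Hy Hz. rewrite <- (sqrt_pow2 (Cmod (y - z))) by apply Cmod_ge_0.
    apply sqrt_le_1_alt. now apply Hclose. }
  destruct (C_cauchy_complete x) as [l Hl].
  { intros eps. apply is_lim_seq_spec in Hsqrtg. destruct (Hsqrtg eps) as [N HN].
    exists N; intros n m Hn Hm. specialize (HN N (le_n _)).
    rewrite Rminus_0_r, Rabs_pos_eq in HN by apply sqrt_pos.
    eapply Rle_lt_trans; [apply (Hle _ _ N)|exact HN].
    - exact (Hmono N n _ Hn (Hx n)).
    - exact (Hmono N m _ Hm (Hx m)). }
  assert (Hin : inD l).
  (* Every [x k] has eventual bound at most [I + 1], so [c + 1] in [dch_coercive] is at most
     [I + 2]. *)
  { assert (Hk : forall k, Cmod (x k) ^ 2 <= 1 - 2 * (1 - r) ^ 2 / (I + 2)).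
    { intros k. destruct (Hx k) as [Hxk [n0 Hn0]]. specialize (Hn0 n0 (le_n _)).
      assert (H := dch_coercive _ _ r _ Hxk (Horb n0) Hr Hn0).
      assert (Hxs := inD_sq _ Hxk).
      assert (/ (INR k + 1) <= / 1).
      { apply Rinv_le_contravar; [lra|]. assert (Hp := pos_INR k). lra. }
      rewrite Rinv_1 in *.
      assert (2 * (1 - r) ^ 2 / (I + 2) <= 1 - Cmod (x k) ^ 2); [|lra].
      apply Rle_div_l; [lra|]. nra. }
    set (kap := 2 * (1 - r) ^ 2 / (I + 2)) in *.
    assert (Hkap : 0 < kap).
    { apply Rdiv_lt_0_compat; [|lra]. assert (0 < (1 - r) ^ 2) by (apply pow_lt; lra). lra. }
    assert (Hk1 : 0 <= 1 - kap) by (eapply Rle_trans; [apply pow2_ge_0|apply (Hk O)]).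
    apply inD_sq_inv.
    assert (Hll : Cmod l <= sqrt (1 - kap)).
    { apply Ccv_Cmod_le with x; auto. exists O; intros k _.
      rewrite <- (sqrt_pow2 (Cmod (x k))) by apply Cmod_ge_0. now apply sqrt_le_1_alt. }
    assert (Cmod l ^ 2 <= sqrt (1 - kap) ^ 2) by (apply pow_incr; split; auto using Cmod_ge_0).
    rewrite pow2_sqrt in * by auto. lra. }
  exists l. split; auto.
  apply Ccv_unique with (u := fun n => f (x n)); [now apply Hcont|].
  apply Ccv_ext with (fun n => ((f (x n) - x n) + x n)%C); [exists O; intros; ring|].
  apply Ccv_eq with (0 + l)%C; [ring|]. apply Ccv_plus; auto.
  apply Ccv_bound with (2 := Hsqrtg). exists O; intros k _.
  replace (f (x k) - x k - 0)%C with (f (x k) - x k)%C by ring. apply Hle; auto.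
Qed.

(** * Schwarz-Pick inequality *)

Lemma pick_diag (f : C -> C) (x : C) :
  inD x -> pick_kernel 1 f x x = RtoC ((1 - Cmod (f x) ^ 2) / (1 - Cmod x ^ 2)).
Proof.
  intros Hx. apply inD_sq in Hx. unfold pick_kernel.
  rewrite (Cmult_comm (Cconj (f x))), (Cmult_comm (Cconj x)), <- !Cmod2_conj.
  rewrite <- !RtoC_minus, <- RtoC_inv, <- RtoC_mult by lra. f_equal. field. lra.
Qed.

Lemma pick_kernel_conj (f : C -> C) (x y : C) :
  inD x -> inD y -> pick_kernel 1 f y x = Cconj (pick_kernel 1 f x y).
Proof.
  intros Hx Hy. unfold pick_kernel.
  rewrite Cmult_conj, Cinv_conj, !Cminus_conj, !Cmult_conj, !Cconj_conj
    by (now apply one_minus_conj_neq_0).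
  rewrite Cconj_1.
  replace (Cconj (1 ^ 2)%R) with (RtoC (1 ^ 2)) by (apply injective_projections; simpl; ring).
  rewrite (Cmult_comm (Cconj (f y))), (Cmult_comm (Cconj y)). reflexivity.
Qed.

(** The two-point determinant inequality for the Pick kernel, with its denominators rearranged into
    those of [dch]. *)
Lemma schwarz_pick (f : C -> C) (x y : C) :
  (forall z, inD z -> inD (f z)) -> psd (pick_kernel 1 f) -> inD x -> inD y ->
  dch (f x) (f y) <= dch x y.
Proof.
  intros Hf HK Hx Hy.
  destruct (psd_two_points _ x y _ _ HK Hx Hy (pick_diag f x Hx) (pick_diag f y Hy)
    (pick_kernel_conj f x y Hx Hy)) as (_ & _ & H).
  unfold pick_kernel in H. rewrite pow1 in H.
  assert (Hn := one_minus_conj_neq_0 x y Hx Hy).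
  rewrite Cmod_mult, Cmod_inv in H by auto.
  apply Cmod_gt_0 in Hn.
  assert (Hfx := inD_sq _ (Hf x Hx)). assert (Hfy := inD_sq _ (Hf y Hy)).
  apply inD_sq in Hx, Hy. unfold dch.
  set (A := Cmod (1 - Cconj (f x) * f y)) in *. set (b := Cmod (1 - Cconj x * y)) in *.
  set (p1 := 1 - Cmod (f x) ^ 2) in *. set (p2 := 1 - Cmod (f y) ^ 2) in *.
  set (q1 := 1 - Cmod x ^ 2) in *. set (q2 := 1 - Cmod y ^ 2) in *.
  assert (H1 : 2 * A ^ 2 / (p1 * p2) <= 2 * b ^ 2 / (q1 * q2)); [|lra].
  apply Rle_div_l; [nra|].
  replace (2 * A ^ 2) with (2 * b ^ 2 * (A * / b) ^ 2) by (field; lra).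
  replace (2 * b ^ 2 / (q1 * q2) * (p1 * p2)) with (2 * b ^ 2 * (p1 / q1 * (p2 / q2)))
    by (field; lra).
  apply Rmult_le_compat_l; [nra|exact H].
Qed.

(** * Dynamics at an interior fixed point *)

Lemma is_derive_Cinv (z : C) :
  z <> 0 -> is_derive (K := C_AbsRing) (V := C_NormedModule) Cinv z (- / (z * z))%C.
Proof.
  intros Hz. split; [apply is_linear_scal_l|].
  intros x Hx. apply (is_filter_lim_locally_unique (V := AbsRing_NormedModule C_AbsRing)) in Hx. subst x.
  intros eps.
  assert (Hz0 := proj1 (Cmod_gt_0 z) Hz).
  (* The first bound keeps [|y| > |z| / 2]; the second absorbs the remainder
     [(y - z)^2 / (y z^2)]. *)
  assert (Hd : 0 < Rmin (Cmod z / 2) (eps * (Cmod z * (Cmod z * Cmod z)) / 2)).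
  { apply Rmin_pos; [lra|]. assert (He := cond_pos eps).
    assert (0 < Cmod z * (Cmod z * Cmod z)) by (repeat apply Rmult_lt_0_compat; auto). nra. }
  exists (mkposreal _ Hd). intros y Hy. change C in (type of y).
  assert (Hyz : Cmod (y - z) < Rmin (Cmod z / 2) (eps * (Cmod z * (Cmod z * Cmod z)) / 2)) by exact Hy.
  change (Cmod ((/ y - / z) - (y - z) * (- / (z * z))) <= eps * Cmod (y - z)).
  assert (H1 := Rlt_le_trans _ _ _ Hyz (Rmin_l _ _)).
  assert (H2 := Rlt_le_trans _ _ _ Hyz (Rmin_r _ _)).
  assert (Hge : Cmod z / 2 < Cmod y).
  { assert (H := Cmod_triangle y (- (y - z))).
    rewrite Cmod_opp in H. replace (y + - (y - z))%C with z in H by ring. lra. }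
  assert (Hy0 : y <> 0) by (apply Cmod_gt_0; lra).
  replace ((/ y - / z) - (y - z) * (- / (z * z)))%C
    with ((y - z) * (y - z) * / (y * (z * z)))%C by (field; auto).
  assert (Hyzz : (y * (z * z))%C <> 0) by (repeat apply Cmult_neq_0; auto).
  rewrite Cmod_mult, Cmod_inv, !Cmod_mult by auto.
  rewrite (Rmult_comm eps), Rmult_assoc. apply Rmult_le_compat_l; [apply Cmod_ge_0|].
  apply Rmult_le_reg_r with (Cmod y * (Cmod z * Cmod z)); [repeat apply Rmult_lt_0_compat; lra|].
  rewrite Rmult_assoc, Rinv_l, Rmult_1_r.
  2:{ apply Rgt_not_eq. repeat apply Rmult_lt_0_compat; lra. }
  assert (He := cond_pos eps).
  assert (eps * (Cmod z / 2 * (Cmod z * Cmod z)) <= eps * (Cmod y * (Cmod z * Cmod z))).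
  { apply Rmult_le_compat_l; [lra|]. apply Rmult_le_compat_r; nra. }
  lra.
Qed.

(* The two canonical normed-module structures on [C] are not convertible: [is_derive_comp]
   and [is_derive_mult] use the first one, [holo_on_D] the second. *)
Lemma is_derive_C_modules (f : C -> C) (z l : C) :
  is_derive (K := C_AbsRing) (V := AbsRing_NormedModule C_AbsRing) f z l <->
  is_derive (K := C_AbsRing) (V := C_NormedModule) f z l.
Proof.
  split; intros [_ H]; (split; [apply is_linear_scal_l|]); intros x Hx eps; exact (H x Hx eps).
Qed.

Lemma is_derive_affine (a b z : C) :
  is_derive (K := C_AbsRing) (V := C_NormedModule) (fun z => (a + z * b)%C) z b.
Proof.
  assert (H := is_derive_plus (K := C_AbsRing) (V := C_NormedModule) _ _ z _ _
    (is_derive_const a z)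
    (is_derive_scal_l (V := C_NormedModule) _ z _ b (is_derive_id (K := C_AbsRing) z))).
  change (is_derive (K := C_AbsRing) (V := C_NormedModule) (fun z => (a + z * b)%C) z
     (0 + 1 * b)%C) in H.
  now replace (0 + 1 * b)%C with b in H by ring.
Qed.

(** The disc automorphism exchanging [0] and [p]; the sign [p - z] makes it an involution. *)
Definition blaschke (p z : C) : C := ((p - z) * / (1 - Cconj p * z))%C.

(** The kernel [1 - conj x * y] is preserved up to factors depending on [x] alone and on [y] alone.
    The case [x = y] shows that the disc is mapped into itself. *)
Lemma blaschke_one_minus (p x y : C) :
  inD p -> inD x -> inD y ->
  ((1 - Cconj (blaschke p x) * blaschke p y)
   = (1 - Cconj p * p) * (1 - Cconj x * y)
      * / ((1 - Cconj x * p) * (1 - Cconj p * y)))%C.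
Proof.
  intros Hp Hx Hy. unfold blaschke.
  assert (H1 := one_minus_conj_neq_0 p y Hp Hy).
  assert (H2 := one_minus_conj_neq_0 x p Hx Hp).
  rewrite Cmult_conj, Cinv_conj, !Cminus_conj, Cmult_conj, Cconj_conj
    by (now apply one_minus_conj_neq_0).
  rewrite Cconj_1.
  rewrite (Cmult_comm p (Cconj x)). field. auto.
Qed.

Lemma blaschke_inD (p z : C) : inD p -> inD z -> inD (blaschke p z).
Proof.
  intros Hp Hz. apply inD_sq_inv.
  assert (E := blaschke_one_minus p z z Hp Hz Hz).
  rewrite (Cmult_comm (Cconj (blaschke p z))), (Cmult_comm (Cconj p) p),
    (Cmult_comm (Cconj z) z), <- !Cmod2_conj in E.
  assert (Hn := one_minus_conj_neq_0 p z Hp Hz).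
  replace (1 - Cconj z * p)%C with (Cconj (1 - Cconj p * z)) in E.
  2:{ rewrite Cminus_conj, Cmult_conj, Cconj_conj.
      rewrite Cconj_1. ring. }
  rewrite (Cmult_comm (Cconj (1 - Cconj p * z))), <- Cmod2_conj in E.
  apply Cmod_gt_0 in Hn.
  assert (0 < Cmod (1 - Cconj p * z) ^ 2) by (apply pow_lt; auto).
  rewrite <- !RtoC_minus, <- RtoC_inv, <- !RtoC_mult in E by lra.
  apply RtoC_inj in E. rewrite E.
  apply inD_sq in Hp, Hz. repeat apply Rmult_lt_0_compat; auto.
  now apply Rinv_0_lt_compat.
Qed.

Lemma one_minus_sq_neq_0 (p : C) : inD p -> (1 - Cconj p * p)%C <> 0.
Proof. intros; now apply one_minus_conj_neq_0. Qed.

Lemma blaschke_invol (p z : C) : inD p -> inD z -> blaschke p (blaschke p z) = z.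
Proof.
  intros Hp Hz.
  assert (H1 := one_minus_conj_neq_0 p z Hp Hz).
  assert (H2 := one_minus_sq_neq_0 p Hp).
  unfold blaschke.
  assert (E : (1 - Cconj p * ((p - z) * / (1 - Cconj p * z)))%C
     = ((1 - Cconj p * p) * / (1 - Cconj p * z))%C) by (field; auto).
  rewrite E. field. auto.
Qed.

Lemma blaschke_dist (p z : C) : inD p -> inD z -> Cmod (z - p) <= 2 * Cmod (blaschke p z).
Proof.
  intros Hp Hz.
  assert (H1 := one_minus_conj_neq_0 p z Hp Hz).
  replace (z - p)%C with (- ((1 - Cconj p * z) * blaschke p z))%C by (unfold blaschke; field; auto).
  rewrite Cmod_opp, Cmod_mult. apply Rmult_le_compat_r; [apply Cmod_ge_0|].
  eapply Rle_trans; [apply (Cmod_triangle 1 (- (Cconj p * z)))|].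
  rewrite Cmod_1, Cmod_opp, Cmod_mult, Cmod_conj. unfold inD in *.
  assert (H2 := Cmod_ge_0 p). assert (H3 := Cmod_ge_0 z). nra.
Qed.

Lemma blaschke_eq_0 (p z : C) : inD p -> inD z -> blaschke p z = 0 -> z = p.
Proof.
  intros Hp Hz H. assert (Hd := blaschke_dist p z Hp Hz). rewrite H, Cmod_0 in Hd.
  assert (H0 := Cmod_ge_0 (z - p)).
  assert (E : (z - p)%C = 0) by (apply Cmod_eq_0; lra).
  replace z with ((z - p) + p)%C by ring. rewrite E. ring.
Qed.

Lemma is_derive_blaschke (p z : C) :
  inD p -> inD z -> exists l, is_derive (K := C_AbsRing) (V := C_NormedModule) (blaschke p) z l.
Proof.
  intros Hp Hz.
  assert (H1 := one_minus_conj_neq_0 p z Hp Hz).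
  assert (Hn : (1 + z * (- Cconj p))%C <> 0).
  { replace (1 + z * (- Cconj p))%C with (1 - Cconj p * z)%C by ring. exact H1. }
  assert (Hinv := is_derive_comp (K := C_AbsRing) (V := C_NormedModule) Cinv _ z _ _
     (is_derive_Cinv _ Hn)
     (proj2 (is_derive_C_modules _ _ _) (is_derive_affine 1 (- Cconj p) z))).
  assert (H := is_derive_mult (K := C_AbsRing) _ _ z _ _
     (proj2 (is_derive_C_modules _ _ _) (is_derive_affine p (- (1)) z))
     (proj2 (is_derive_C_modules _ _ _) Hinv) Cmult_comm).
  eexists. apply is_derive_C_modules. eapply is_derive_ext; [|exact H].
  intros t. change ((p + t * (- (1))) * / (1 + t * (- Cconj p)) = blaschke p t)%C.
  unfold blaschke. f_equal; [|f_equal]; ring.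
Qed.

Lemma holo_comp (f g : C -> C) :
  holo_on_D f -> self_map g -> holo_on_D (fun z => f (g z)).
Proof.
  intros Hf [Hg Hgd] z Hz. destruct (Hg z Hz) as [dg Hdg].
  destruct (Hf (g z) (Hgd z Hz)) as [df Hdf].
  eexists. exact (is_derive_comp (K := C_AbsRing) (V := C_NormedModule) f g z _ _ Hdf
    (proj2 (is_derive_C_modules _ _ _) Hdg)).
Qed.

Lemma self_map_blaschke (p : C) : inD p -> self_map (blaschke p).
Proof.
  intros Hp. split; [intros z Hz; now apply is_derive_blaschke|].
  intros z; now apply blaschke_inD.
Qed.

Lemma self_map_rotation (l : C) : Cmod l = 1 -> self_map (fun z => (l * z)%C).
Proof.
  intros Hl. split.
  - intros z Hz. exists l. eapply is_derive_ext; [|exact (is_derive_affine 0 l z)].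
    intros t. change ((0 + t * l)%C = (l * t)%C). ring.
  - intros z Hz. unfold inD in *. rewrite Cmod_mult, Hl. lra.
Qed.

Lemma self_map_comp (f g : C -> C) :
  self_map f -> self_map g -> self_map (fun z => f (g z)).
Proof.
  intros [Hf Hfd] Hg. split; [now apply holo_comp|]. destruct Hg; auto.
Qed.

Lemma psd_rescale (s : C -> C) (K : C -> C -> C) :
  psd K -> psd (fun x y => (s x * Cconj (s y) * K x y)%C).
Proof.
  intros HK n c z Hz. specialize (HK n (fun i => (c i * s (z i))%C) z Hz).
  replace (quad (fun x y => (s x * Cconj (s y) * K x y)%C) c z n)
    with (quad K (fun i => (c i * s (z i))%C) z n); auto.
  apply csum_ext; intros i _. apply csum_ext; intros j _. rewrite Cmult_conj. ring.
Qed.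

(* Up to a factor [conj X * Y], with [X = blaschke p x] and [Y = blaschke p y], this is
   [(1 - conj (k x) * k y) / (1 - conj X * Y)] for [k x = blaschke p (f x) / X]; this form
   avoids the division at [x = p]. *)
Definition schur_kernel (p : C) (f : C -> C) (x y : C) : C :=
  ((Cconj (blaschke p x) * blaschke p y - Cconj (blaschke p (f x)) * blaschke p (f y))
   * / (1 - Cconj (blaschke p x) * blaschke p y))%C.

(** The Pick kernel equals [1] at [(p, p)] because [p] is fixed, so [psd_schur] applies there. This
    plays the role of dividing by the zero at [p] in the Schwarz lemma. *)
Lemma psd_schur_kernel (p : C) (f : C -> C) :
  (forall z, inD z -> inD (f z)) -> inD p -> f p = p -> psd (pick_kernel 1 f) ->
  psd (schur_kernel p f).
Proof.
  intros Hf Hp Hfp HK.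
  assert (Hpp : pick_kernel 1 f p p = 1).
  { unfold pick_kernel. rewrite Hfp, pow1. field. now apply one_minus_sq_neq_0. }
  assert (HS := psd_schur _ p Hp Hpp (pick_kernel_conj f) HK).
  (* The factor is [1 / K x p] for the Pick kernel [K]. It turns the subtracted product into [1] and
     [K x y] into [(1 - conj U * V) / (1 - conj X * Y)], where [U], [V] are the Blaschke coordinates
     of [f x], [f y]. *)
  apply psd_rescale with (s := fun x => ((1 - Cconj x * p) * / (1 - Cconj (f x) * p))%C) in HS.
  revert HS. apply psd_ext. intros x y Hx Hy.
  assert (Hfx := Hf x Hx). assert (Hfy := Hf y Hy).
  unfold schur_kernel.
  replace (Cconj (blaschke p x) * blaschke p y - Cconj (blaschke p (f x)) * blaschke p (f y))%C
    with ((1 - Cconj (blaschke p (f x)) * blaschke p (f y))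
          - (1 - Cconj (blaschke p x) * blaschke p y))%C by ring.
  rewrite !blaschke_one_minus by auto.
  unfold pick_kernel. rewrite Hfp, pow1.
  rewrite Cmult_conj, Cinv_conj, !Cminus_conj, !Cmult_conj, !Cconj_conj
    by (now apply one_minus_conj_neq_0).
  rewrite Cconj_1.
  assert (H1 := one_minus_conj_neq_0 p y Hp Hy).
  assert (H2 := one_minus_conj_neq_0 x p Hx Hp).
  assert (H3 := one_minus_conj_neq_0 p (f y) Hp Hfy).
  assert (H4 := one_minus_conj_neq_0 (f x) p Hfx Hp).
  assert (H5 := one_minus_conj_neq_0 x y Hx Hy).
  assert (H6 := one_minus_sq_neq_0 p Hp).
  rewrite (Cmult_comm y (Cconj p)), (Cmult_comm (f y) (Cconj p)).
  field. repeat split; auto.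
Qed.

Lemma schur_kernel_diag (p : C) (f : C -> C) (x : C) :
  inD p -> inD x ->
  schur_kernel p f x x = RtoC ((Cmod (blaschke p x) ^ 2 - Cmod (blaschke p (f x)) ^ 2)
                               / (1 - Cmod (blaschke p x) ^ 2)).
Proof.
  intros Hp Hx. assert (H := inD_sq _ (blaschke_inD p x Hp Hx)). unfold schur_kernel.
  rewrite (Cmult_comm (Cconj (blaschke p x))), (Cmult_comm (Cconj (blaschke p (f x)))),
    <- !Cmod2_conj.
  rewrite <- !RtoC_minus, <- RtoC_inv, <- RtoC_mult by lra. reflexivity.
Qed.

Lemma schur_kernel_conj (p : C) (f : C -> C) (x y : C) :
  inD p -> inD x -> inD y -> schur_kernel p f y x = Cconj (schur_kernel p f x y).
Proof.
  intros Hp Hx Hy. unfold schur_kernel.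
  rewrite Cmult_conj, Cinv_conj, !Cminus_conj, !Cmult_conj, !Cconj_conj
    by (apply one_minus_conj_neq_0; now apply blaschke_inD).
  rewrite Cconj_1.
  rewrite (Cmult_comm (Cconj (blaschke p y))), (Cmult_comm (Cconj (blaschke p (f y)))).
  reflexivity.
Qed.

(** The diagonal of [schur_kernel] gives the Schwarz lemma at [p]; its two-point determinant is
    Schwarz-Pick for the quotient [U / X], with denominators cleared. *)
Lemma schwarz_pick_second (p : C) (f : C -> C) (x y : C) :
  (forall z, inD z -> inD (f z)) -> inD p -> f p = p -> psd (pick_kernel 1 f) ->
  inD x -> inD y ->
  let X := blaschke p x in let Y := blaschke p y in
  let U := blaschke p (f x) in let V := blaschke p (f y) in
  Cmod U <= Cmod X /\
  Cmod (Cconj X * Y - Cconj U * V) ^ 2 * ((1 - Cmod X ^ 2) * (1 - Cmod Y ^ 2))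
   <= (Cmod X ^ 2 - Cmod U ^ 2) * (Cmod Y ^ 2 - Cmod V ^ 2) * Cmod (1 - Cconj X * Y) ^ 2.
Proof.
  intros Hf Hp Hfp HK Hx Hy X Y U V.
  assert (HS := psd_schur_kernel p f Hf Hp Hfp HK).
  destruct (psd_two_points _ x y _ _ HS Hx Hy (schur_kernel_diag p f x Hp Hx)
    (schur_kernel_diag p f y Hp Hy) (schur_kernel_conj p f x y Hp Hx Hy)) as (H1 & _ & H2).
  unfold schur_kernel in H2.
  assert (HX := blaschke_inD p x Hp Hx). assert (HY := blaschke_inD p y Hp Hy).
  fold X U in H1. fold X Y U V in H2. fold X in HX. fold Y in HY.
  assert (Hn := one_minus_conj_neq_0 X Y HX HY).
  rewrite Cmod_mult, Cmod_inv in H2 by auto.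
  apply Cmod_gt_0 in Hn. apply inD_sq in HX, HY.
  split.
  - assert (0 <= Cmod X ^ 2 - Cmod U ^ 2).
    { apply Rmult_le_reg_r with (/ (1 - Cmod X ^ 2)); [now apply Rinv_0_lt_compat|].
      rewrite Rmult_0_l. exact H1. }
    assert (H3 := Cmod_ge_0 X). assert (H4 := Cmod_ge_0 U). nra.
  - set (A := Cmod (Cconj X * Y - Cconj U * V)) in *. set (b := Cmod (1 - Cconj X * Y)) in *.
    set (q1 := 1 - Cmod X ^ 2) in *. set (q2 := 1 - Cmod Y ^ 2) in *.
    set (p1 := Cmod X ^ 2 - Cmod U ^ 2) in *. set (p2 := Cmod Y ^ 2 - Cmod V ^ 2) in *.
    replace (A ^ 2 * (q1 * q2)) with ((A * / b) ^ 2 * (b ^ 2 * (q1 * q2))) by (field; lra).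
    replace (p1 * p2 * b ^ 2) with (p1 / q1 * (p2 / q2) * (b ^ 2 * (q1 * q2))) by (field; lra).
    apply Rmult_le_compat_r; [|exact H2].
    apply Rmult_le_pos; [apply pow2_ge_0|]. apply Rlt_le, Rmult_lt_0_compat; auto.
Qed.

(** Strict decrease at a single [y] spreads to every [x] through the two-point inequality; with no
    decrease anywhere, the right-hand side vanishes and [f] is rigid. *)
Lemma fixed_point_dichotomy (f : C -> C) (p : C) :
  self_map f -> psd (pick_kernel 1 f) -> inD p -> f p = p ->
  elliptic_aut f \/ iterates_converge_to f p.
Proof.
  intros Hself HK Hp Hfp. assert (Hf := proj2 Hself).
  assert (HSP := fun x y => schwarz_pick_second p f x y Hf Hp Hfp HK). cbv zeta in HSP.
  destruct (classic (exists y, inD y /\ Cmod (blaschke p (f y)) < Cmod (blaschke p y)))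
    as [(y & Hy & Hlt)|Hall].
  - right. intros z Hz. apply Ccv_filterlim.
    set (Y := blaschke p y) in *. set (V := blaschke p (f y)) in *.
    assert (HY := inD_sq _ (blaschke_inD p y Hp Hy)). fold Y in HY.
    assert (HV0 := Cmod_ge_0 V).
    (* The [4] bounds [|1 - conj X * Y|^2]; [kap] comes from solving the two-point inequality for
       [|X|^2 - |U|^2]. *)
    set (D := 4 * (Cmod Y ^ 2 - Cmod V ^ 2)).
    assert (HYV : 0 < (Cmod Y - Cmod V) * (Cmod Y + Cmod V)) by (apply Rmult_lt_0_compat; lra).
    assert (HD : 0 < D) by (unfold D; lra).
    set (kap := (Cmod Y - Cmod V) ^ 2 * (1 - Cmod Y ^ 2) / D).
    assert (Hkap : 0 < kap).
    { apply Rdiv_lt_0_compat; auto. apply Rmult_lt_0_compat; auto. apply pow_lt; lra. }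
    assert (Hstep : forall x, inD x -> Cmod (blaschke p (f x)) ^ 2
        <= Cmod (blaschke p x) ^ 2 * (1 - kap * (1 - Cmod (blaschke p x) ^ 2))).
    { intros x Hx. destruct (HSP x y Hx Hy) as [HUX H].
      assert (HX := blaschke_inD p x Hp Hx).
      fold Y V in H. set (X := blaschke p x) in *. set (U := blaschke p (f x)) in *.
      assert (HX0 := Cmod_ge_0 X). assert (HU0 := Cmod_ge_0 U).
      assert (HX1 : Cmod X < 1) by exact HX. apply inD_sq in HX.
      assert (HY1 : Cmod Y < 1) by (apply inD_sq_inv in HY; exact HY).
      assert (Hb : Cmod (1 - Cconj X * Y) <= 2).
      { eapply Rle_trans; [apply (Cmod_triangle 1 (- (Cconj X * Y)))|].
        rewrite Cmod_1, Cmod_opp, Cmod_mult, Cmod_conj. nra. }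
      assert (Hb2 : Cmod (1 - Cconj X * Y) ^ 2 <= 4).
      { replace 4 with (2 ^ 2) by ring. apply pow_incr; split; auto using Cmod_ge_0. }
      (* Since [|U| <= |X|], subtracting [conj U * V] removes at most [|X| |V|]. *)
      assert (HA : Cmod X * (Cmod Y - Cmod V) <= Cmod (Cconj X * Y - Cconj U * V)).
      { assert (Ht := Cmod_triangle (Cconj X * Y - Cconj U * V) (Cconj U * V)).
        replace (Cconj X * Y - Cconj U * V + Cconj U * V)%C with (Cconj X * Y)%C in Ht by ring.
        rewrite !Cmod_mult, !Cmod_conj in Ht. nra. }
      assert (HA2 : (Cmod X * (Cmod Y - Cmod V)) ^ 2 <= Cmod (Cconj X * Y - Cconj U * V) ^ 2).
      { apply pow_incr; split; auto. apply Rmult_le_pos; lra. }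
      set (A2 := Cmod (Cconj X * Y - Cconj U * V) ^ 2) in *.
      set (b2 := Cmod (1 - Cconj X * Y) ^ 2) in *.
      assert (HXU : 0 <= Cmod X ^ 2 - Cmod U ^ 2) by nra.
      assert (H1 : (Cmod X * (Cmod Y - Cmod V)) ^ 2 * ((1 - Cmod X ^ 2) * (1 - Cmod Y ^ 2))
                <= (Cmod X ^ 2 - Cmod U ^ 2) * D).
      { apply Rle_trans with (A2 * ((1 - Cmod X ^ 2) * (1 - Cmod Y ^ 2))).
        - apply Rmult_le_compat_r; auto. nra.
        - eapply Rle_trans; [exact H|]. unfold D.
          rewrite Rmult_assoc. apply Rmult_le_compat_l; auto.
          assert (0 <= Cmod Y ^ 2 - Cmod V ^ 2) by nra. nra. }
      assert (H2 : Cmod X ^ 2 * (1 - Cmod X ^ 2) * kap <= Cmod X ^ 2 - Cmod U ^ 2).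
      { unfold kap. apply Rmult_le_reg_r with D; auto.
        replace (Cmod X ^ 2 * (1 - Cmod X ^ 2) * ((Cmod Y - Cmod V) ^ 2 * (1 - Cmod Y ^ 2) / D) * D)
          with ((Cmod X * (Cmod Y - Cmod V)) ^ 2 * ((1 - Cmod X ^ 2) * (1 - Cmod Y ^ 2)))
          by (field; lra). exact H1. }
      lra. }
    set (zn := fun n => Nat.iter n f z).
    assert (Hzn : forall n, inD (zn n)) by (intros; now apply iter_inD).
    set (t := fun n => Cmod (blaschke p (zn n))).
    assert (Ht0 : forall n, 0 <= t n) by (intros; apply Cmod_ge_0).
    assert (Htmono : forall n, t n <= t O).
    { induction n as [|n IH]; [lra|]. eapply Rle_trans; [|exact IH].
      apply (HSP (zn n) p (Hzn n) Hp). }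
    assert (Ht1 := inD_sq _ (blaschke_inD p (zn O) Hp (Hzn O))). fold (t O) in Ht1.
    (* One factor serves all steps because [t] does not increase; the maximum with [0] makes its
       square root usable without an upper bound on [kap]. *)
    set (rho := Rmax 0 (1 - kap * (1 - t O ^ 2))).
    assert (Hrho : 0 <= rho < 1).
    { split; [apply Rmax_l|]. apply Rmax_lub_lt; [lra|]. nra. }
    assert (Hrec : forall n, t (S n) <= sqrt rho * t n).
    { intros n. rewrite <- (sqrt_pow2 (t (S n))), <- (sqrt_pow2 (t n)), <- sqrt_mult
        by (auto; try lra; apply pow2_ge_0).
      apply sqrt_le_1_alt. eapply Rle_trans; [apply (Hstep (zn n) (Hzn n))|]. fold (t n).
      rewrite Rmult_comm. apply Rmult_le_compat_r; [apply pow2_ge_0|].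
      eapply Rle_trans; [|apply Rmax_r].
      assert (t n ^ 2 <= t O ^ 2) by (apply pow_incr; auto). nra. }
    assert (Hgeo : forall n, t n <= sqrt rho ^ n * t O).
    { induction n as [|n IH]; [simpl; lra|].
      eapply Rle_trans; [apply Hrec|]. simpl. rewrite Rmult_assoc.
      apply Rmult_le_compat_l; auto. apply sqrt_pos. }
    apply Ccv_bound with (fun n => 2 * (sqrt rho ^ n * t O)).
    + exists O; intros n _. eapply Rle_trans; [apply (blaschke_dist p (zn n) Hp (Hzn n))|].
      fold (t n). specialize (Hgeo n). lra.
    + replace (Finite 0) with (Finite (2 * (0 * t O))) by (f_equal; ring).
      repeat apply is_lim_seq_mult'; try apply is_lim_seq_const.
      apply is_lim_seq_geom. rewrite Rabs_pos_eq by apply sqrt_pos.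
      rewrite <- sqrt_1. apply sqrt_lt_1_alt. lra.
  - left.
    assert (Heq : forall y, inD y -> Cmod (blaschke p (f y)) = Cmod (blaschke p y)).
    { intros y Hy. apply Rle_antisym; [apply (HSP y p Hy Hp)|].
      apply Rnot_lt_le. intros H. apply Hall. now exists y. }
    assert (Hrig : forall x y, inD x -> inD y ->
      (Cconj (blaschke p x) * blaschke p y = Cconj (blaschke p (f x)) * blaschke p (f y))%C).
    { intros x y Hx Hy. destruct (HSP x y Hx Hy) as [_ H].
      rewrite !Heq in H by auto.
      assert (HX := inD_sq _ (blaschke_inD p x Hp Hx)).
      assert (HY := inD_sq _ (blaschke_inD p y Hp Hy)).
      set (w := (Cconj (blaschke p x) * blaschke p y - Cconj (blaschke p (f x)) * blaschke p (f y))%C) in *.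
      assert (Hw : Cmod w = 0).
      { assert (H0 := Cmod_ge_0 w).
        assert (Hq : 0 < (1 - Cmod (blaschke p x) ^ 2) * (1 - Cmod (blaschke p y) ^ 2)) by nra.
        set (q := (1 - Cmod (blaschke p x) ^ 2) * (1 - Cmod (blaschke p y) ^ 2)) in *.
        destruct (Rle_lt_or_eq_dec _ _ H0) as [Hpos|]; [|auto].
        assert (0 < Cmod w ^ 2 * q) by (apply Rmult_lt_0_compat; auto; apply pow_lt; auto). lra. }
      apply Cmod_eq_0 in Hw. unfold w in Hw.
      replace (Cconj (blaschke p x) * blaschke p y)%C with
        ((Cconj (blaschke p x) * blaschke p y - Cconj (blaschke p (f x)) * blaschke p (f y))
         + Cconj (blaschke p (f x)) * blaschke p (f y))%C by ring.
      rewrite Hw. ring. }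
    (* Any point other than [p] will do as the reference point. *)
    assert (Hex : exists x, inD x /\ blaschke p x <> 0).
    { destruct (classic (p = 0)) as [->|Hp0].
      - exists (RtoC (1 / 2)). assert (Hh : inD (RtoC (1 / 2))) by (unfold inD; rewrite Cmod_R, Rabs_pos_eq; lra).
        split; auto. intros E. apply blaschke_eq_0 in E; auto. apply RtoC_inj in E. lra.
      - exists 0. assert (Hh : inD 0) by (unfold inD; rewrite Cmod_0; lra).
        split; auto. intros E. apply blaschke_eq_0 in E; auto. }
    destruct Hex as (x & Hx & HX).
    set (X := blaschke p x) in *. set (U := blaschke p (f x)).
    assert (HUX : Cmod U = Cmod X) by now apply Heq.
    assert (HU : U <> 0) by (apply Cmod_gt_0; rewrite HUX; now apply Cmod_gt_0).
    assert (HUc : Cconj U <> 0) by (apply Cmod_gt_0; rewrite Cmod_conj; now apply Cmod_gt_0).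
    (* Rigidity read at the fixed [x] gives [V = l * Y] for every [y]: in the coordinate
       [blaschke p], the map is the rotation by [l]. *)
    set (l := (Cconj X * / Cconj U)%C).
    assert (Hl : Cmod l = 1).
    { unfold l. rewrite Cmod_mult, Cmod_inv, !Cmod_conj, HUX by auto.
      apply Rinv_r. apply Rgt_not_eq. now apply Cmod_gt_0. }
    assert (Hlc : (l * Cconj l)%C = 1) by now apply Cmod1_conj.
    assert (Hbf : forall y, inD y -> blaschke p (f y) = (l * blaschke p y)%C).
    { intros y Hy. assert (H := Hrig x y Hx Hy). fold X U in H.
      unfold l. transitivity ((Cconj X * blaschke p y) * / Cconj U)%C; [rewrite H; field; auto|ring]. }
    split.
    + split; auto.
      exists (fun z => blaschke p (Cconj l * blaschke p z)%C). split.
      * apply (self_map_comp (blaschke p) (fun z => Cconj l * blaschke p z)%C);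
          [now apply self_map_blaschke|].
        apply (self_map_comp (fun w => Cconj l * w)%C (blaschke p)).
        -- apply self_map_rotation. now rewrite Cmod_conj.
        -- now apply self_map_blaschke.
      * intros z Hz. split.
        -- rewrite Hbf, Cmult_assoc, (Cmult_comm (Cconj l)), Hlc, Cmult_1_l by auto.
           now apply blaschke_invol.
        -- assert (Hw : inD (Cconj l * blaschke p z)).
           { apply (self_map_rotation (Cconj l)); [now rewrite Cmod_conj|now apply blaschke_inD]. }
           assert (Hw' := blaschke_inD p _ Hp Hw).
           rewrite <- (blaschke_invol p (f _)) by auto.
           rewrite Hbf, blaschke_invol, Cmult_assoc, Hlc, Cmult_1_l by auto.
           now apply blaschke_invol.
    + now exists p.
Qed.

(** * The orbit of the origin *)

Lemma wt_bound (beta : R) (n : nat) : -1 < beta -> 0 < wt beta n <= 1.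
Proof.
  intros Hb. induction n as [|n IH]; simpl; [lra|].
  assert (Hn := pos_INR n).
  assert (Hq : 0 < (INR n + 1) / (INR n + 2 + beta) <= 1).
  { split; [apply Rdiv_lt_0_compat; lra|]. apply Rle_div_l; lra. }
  nra.
Qed.

(** The difference of the coefficients represents the zero function, and [coef_square_sum_bound]
    with [M = 0] makes it vanish. *)
Lemma is_coef_unique (a b : nat -> C) (f : C -> C) :
  is_coef a f -> is_coef b f -> forall n, a n = b n.
Proof.
  intros Ha Hb n.
  assert (H : is_coef (fun n => (a n - b n)%C) (fun _ => 0)).
  { intros z Hz. apply is_series_Ccv.
    apply Ccv_ext with (fun n => poly a n z + - (1) * poly b n z)%C.
    - exists O; intros k _. unfold poly. rewrite <- csum_scal, <- csum_plus.
      apply csum_ext; intros; ring.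
    - apply Ccv_eq with (f z + - (1) * f z)%C; [ring|].
      apply Ccv_plus; [|apply Ccv_scal]; now apply is_coef_Ccv. }
  assert (H0 : sum_n (fun k => Cmod (a k - b k) ^ 2) n <= 0 ^ 2).
  { apply (coef_square_sum_bound (fun k => (a k - b k)%C) (fun _ => 0)); auto.
    intros; rewrite Cmod_0; lra. }
  assert (H1 : Cmod (a n - b n) ^ 2 <= sum_n (fun k => Cmod (a k - b k) ^ 2) n).
  { destruct n as [|n]; [rewrite sum_O; lra|]. rewrite sum_Sn.
    change (plus ?x ?y) with (x + y)%R.
    assert (0 <= sum_n (fun k => Cmod (a k - b k) ^ 2) n); [|lra].
    rewrite sum_n_Reals. apply cond_pos_sum. intros; apply pow2_ge_0. }
  assert (H2 := Cmod_ge_0 (a n - b n)).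
  assert (E : (a n - b n)%C = 0) by (apply Cmod_eq_0; nra).
  replace (a n) with ((a n - b n) + b n)%C by ring. rewrite E; ring.
Qed.

(** Eliminates [epsilon]: uniqueness of coefficients and of limits leaves only one value to
    choose. *)
Lemma A2_ip_eq (beta : R) (f g : C -> C) (a b : nat -> C) (v : C) :
  is_coef a f -> is_coef b g ->
  Ccv (csum (fun n => (RtoC (wt beta n) * a n * Cconj (b n))%C)) v ->
  A2_ip beta f g = v.
Proof.
  intros Ha Hb Hv.
  assert (Hex : exists v, A2_ip_is beta f g v).
  { exists v, a, b. repeat split; auto. now apply is_series_Ccv. }
  destruct (epsilon_spec (inhabits (RtoC 0)) (A2_ip_is beta f g) Hex) as (a' & b' & Ha' & Hb' & H).
  fold (A2_ip beta f g) in H. apply is_series_Ccv in H.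
  apply Ccv_unique with (1 := H). apply Ccv_ext with (2 := Hv).
  exists O; intros n _. apply csum_ext; intros i _.
  now rewrite (is_coef_unique a a' f Ha Ha'), (is_coef_unique b b' g Hb Hb').
Qed.

Definition delta (m n : nat) : C := if Nat.eqb n m then 1 else 0.

Lemma csum_delta (u : nat -> C) (m n : nat) :
  (m < n)%nat -> (forall k, k <> m -> u k = 0) -> csum u n = u m.
Proof.
  intros Hmn Hu. induction n as [|n IH]; [lia|]. simpl.
  destruct (Nat.eq_dec n m) as [->|Hne].
  - rewrite csum_zero by (intros; apply Hu; lia). ring.
  - rewrite IH, (Hu n) by lia. ring.
Qed.

Lemma is_coef_monomial (m : nat) : is_coef (delta m) (fun z => Cpow z m).
Proof.
  intros z Hz. apply is_series_Ccv.
  apply Ccv_ext with (fun _ => Cpow z m); [|apply Ccv_const].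
  exists (S m); intros n Hn. rewrite (csum_delta _ m) by
    (auto; intros k Hk; unfold delta; apply Nat.eqb_neq in Hk; rewrite Hk; ring).
  unfold delta. rewrite Nat.eqb_refl. ring.
Qed.

Lemma in_A2_monomial (beta : R) (m : nat) : in_A2 beta (fun z => Cpow z m).
Proof.
  exists (delta m). split; [apply is_coef_monomial|].
  apply (ex_series_incr_n _ (S m)).
  apply ex_series_ext with (fun n => 0 * (/ 2) ^ n).
  - intros n. unfold delta. replace (Nat.eqb (S m + n) m) with false.
    + rewrite Cmod_0. change (0 * (/ 2) ^ n = wt beta (S m + n) * 0 ^ 2). ring.
    + symmetry; apply Nat.eqb_neq; lia.
  - apply (ex_series_scal_l 0 (fun n => (/ 2) ^ n)). apply ex_series_geom.
    rewrite Rabs_pos_eq; lra.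
Qed.

Lemma is_coef_at_0 (a : nat -> C) (f : C -> C) : is_coef a f -> f 0 = a O.
Proof.
  intros Ha. assert (H0 : inD 0) by (unfold inD; rewrite Cmod_0; lra).
  apply Ccv_unique with (1 := is_coef_Ccv a f 0 Ha H0).
  apply Ccv_ext with (fun _ => a O); [|apply Ccv_const].
  exists 1%nat; intros n Hn. unfold poly. rewrite (csum_delta _ O) by
    (auto; intros k Hk; destruct k as [|k]; try lia; rewrite Cpow_S; ring).
  simpl. ring.
Qed.

Lemma A2_pairing_converges (w : nat -> R) (a b : nat -> C) :
  (forall n, 0 <= w n) ->
  ex_series (fun n => w n * (Cmod (a n)) ^ 2) -> ex_series (fun n => w n * (Cmod (b n)) ^ 2) ->
  exists v, Ccv (csum (fun n => (RtoC (w n) * a n * Cconj (b n))%C)) v.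
Proof.
  intros Hw Ha Hb.
  assert (H : ex_series (K := C_AbsRing) (V := C_NormedModule)
     (fun n => (RtoC (w n) * a n * Cconj (b n))%C)).
  { apply (ex_series_le (K := C_AbsRing) (V := C_CompleteNormedModule)) with
      (b := fun n => w n * (Cmod (a n)) ^ 2 + w n * (Cmod (b n)) ^ 2).
    - intros n. change (Cmod (RtoC (w n) * a n * Cconj (b n)) <=
        w n * Cmod (a n) ^ 2 + w n * Cmod (b n) ^ 2).
      rewrite !Cmod_mult, Cmod_conj, Cmod_R, Rabs_pos_eq by auto.
      rewrite Rmult_assoc, <- Rmult_plus_distr_l. apply Rmult_le_compat_l; auto.
      assert (H1 := Cmod_ge_0 (a n)). assert (H2 := Cmod_ge_0 (b n)).
      assert (H3 := pow2_ge_0 (Cmod (a n) - Cmod (b n))). nra.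
    - exact (ex_series_plus _ _ Ha Hb). }
  destruct H as [v Hv]. exists v. now apply is_series_Ccv.
Qed.

Lemma sum_n_le_series (u : nat -> R) (l : R) (n : nat) :
  (forall k, 0 <= u k) -> is_series u l -> sum_n u n <= l.
Proof.
  intros Hu Hl.
  apply is_lim_seq_le_loc with (u := fun _ => sum_n u n) (v := sum_n u)
    (l1 := Finite (sum_n u n)) (l2 := Finite l); auto using is_lim_seq_const.
  exists n; intros m Hm. now apply sum_n_incr.
Qed.

(* AM-GM: [w |a| |b| <= s/2 w|a|^2 + w|b|^2/(2s)] for the terms of index at least 1. *)
Lemma pairing_near_constant (w : nat -> R) (a b : nat -> C) (v : C) (s : R) :
  (forall n, 0 <= w n <= 1) -> w O = 1 -> 0 < s ->
  (forall n, sum_n (fun n => w n * Cmod (a n) ^ 2) n <= 1) ->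
  (forall n, sum_n (fun n => Cmod (b n) ^ 2) n <= 1) ->
  Ccv (csum (fun n => (RtoC (w n) * a n * Cconj (b n))%C)) v ->
  Cmod (v - a O * Cconj (b O)) <= s / 2 + (1 - Cmod (b O) ^ 2) / (2 * s).
Proof.
  intros Hw Hw0 Hs Ha Hb Hv.
  set (u := fun n => (RtoC (w n) * a n * Cconj (b n))%C) in *.
  assert (Hpart : forall n, Cmod (csum u (S n) - u O)
     <= s / 2 * sum_n (fun n => w n * Cmod (a n) ^ 2) n
        + / (2 * s) * (sum_n (fun n => Cmod (b n) ^ 2) n - Cmod (b O) ^ 2)).
  { induction n as [|n IH].
    - rewrite !sum_O. replace (csum u 1 - u O)%C with (RtoC 0) by (simpl; ring).
      rewrite Cmod_0, Rminus_diag, Rmult_0_r, Rplus_0_r.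
      apply Rmult_le_pos; [lra|]. apply Rmult_le_pos; [apply Hw|apply pow2_ge_0].
    - rewrite !sum_Sn. change (plus ?x ?y) with (x + y)%R.
      replace (csum u (S (S n)) - u O)%C with ((csum u (S n) - u O) + u (S n))%C
        by (simpl; ring).
      eapply Rle_trans; [apply Cmod_triangle|].
      assert (Hu : Cmod (u (S n)) <= s / 2 * (w (S n) * Cmod (a (S n)) ^ 2)
                     + / (2 * s) * Cmod (b (S n)) ^ 2).
      { unfold u. destruct (Hw (S n)) as [Hw1 Hw2].
        rewrite !Cmod_mult, Cmod_conj, Cmod_R, Rabs_pos_eq by auto.
        set (x := Cmod (a (S n))). set (y := Cmod (b (S n))). set (c := w (S n)) in *.
        assert (Hc : c * y ^ 2 <= y ^ 2) by (assert (H := pow2_ge_0 y); nra).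
        assert (Hsq : 0 <= c * (/ (2 * s) * (s * x - y) ^ 2)).
        { apply Rmult_le_pos; auto. apply Rmult_le_pos; [|apply pow2_ge_0].
          apply Rlt_le, Rinv_0_lt_compat; lra. }
        replace (c * (/ (2 * s) * (s * x - y) ^ 2))
          with (s / 2 * (c * x ^ 2) - c * x * y + / (2 * s) * (c * y ^ 2)) in Hsq by (field; lra).
        assert (0 < / (2 * s)) by (apply Rinv_0_lt_compat; lra). nra. }
      lra. }
  apply Ccv_Cmod_le with (u := fun n => (csum u n + - (1) * u O)%C).
  - exists 1%nat; intros n Hn. destruct n as [|n]; [lia|].
    replace (csum u (S n) + - (1) * u O)%C with (csum u (S n) - u O)%C by ring.
    eapply Rle_trans; [apply Hpart|]. specialize (Ha n). specialize (Hb n).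
    assert (0 < / (2 * s)) by (apply Rinv_0_lt_compat; lra).
    replace ((1 - Cmod (b O) ^ 2) / (2 * s)) with (/ (2 * s) * (1 - Cmod (b O) ^ 2))
      by (unfold Rdiv; ring).
    apply Rplus_le_compat; [nra|]. apply Rmult_le_compat_l; lra.
  - apply Ccv_eq with (v + - (1) * u O)%C.
    + unfold u. rewrite Hw0. ring.
    + apply Ccv_plus; auto using Ccv_const.
Qed.

Lemma bernoulli (x : R) (m : nat) : 0 <= x <= 1 -> 1 - INR m * x <= (1 - x) ^ m.
Proof.
  intros Hx. induction m as [|m IH]; [simpl; lra|].
  rewrite S_INR. simpl. assert (Hm := pos_INR m).
  assert (0 <= (1 - x) ^ m) by (apply pow_le; lra). nra.
Qed.

Lemma Cpow_near_1 (u : nat -> C) (m : nat) (d : R) :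
  0 < d <= 1 -> (forall r, r < 1 -> exists n, r < Cmod (u n)) ->
  exists n, 1 - d <= Cmod (Cpow (u n) m).
Proof.
  intros Hd Hu. assert (Hm := pos_INR m).
  (* Chosen so that [m * x <= d], whence [(1 - x)^m >= 1 - d] by Bernoulli; the [+ 1] covers
     [m = 0]. *)
  set (x := d / (INR m + 1)).
  assert (Hx : 0 < x) by (apply Rdiv_lt_0_compat; lra).
  assert (Hx1 : x <= d).
  { unfold x. apply Rle_div_l; nra. }
  assert (Hmx : INR m * x <= d).
  { unfold x. replace (INR m * (d / (INR m + 1))) with (INR m * d / (INR m + 1)) by (field; lra).
    apply Rle_div_l; nra. }
  destruct (Hu (1 - x)) as [n Hn]; [lra|]. exists n. rewrite Cmod_pow.
  apply Rle_trans with ((1 - x) ^ m).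
  - assert (H := bernoulli x m). lra.
  - apply pow_incr. lra.
Qed.

Lemma in_A2_iter (beta : R) (phi h : C -> C) (n : nat) :
  (forall f, in_A2 beta f -> in_A2 beta (fun z => f (phi z))) ->
  in_A2 beta h -> in_A2 beta (fun z => h (Nat.iter n phi z)).
Proof.
  intros Hphi Hh. induction n as [|n IH]; [exact Hh|].
  apply Hphi in IH.
  replace (fun z => h (Nat.iter (S n) phi z)) with (fun z => h (Nat.iter n phi (phi z))); auto.
  apply functional_extensionality; intros z. now rewrite Nat.iter_succ_r.
Qed.

Lemma fixed_functional_iter (beta : R) (phi G h : C -> C) (n : nat) :
  (forall f, in_A2 beta f -> in_A2 beta (fun z => f (phi z))) ->
  (forall g, in_A2 beta g -> A2_ip beta G g = A2_ip beta G (fun z => g (phi z))) ->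
  in_A2 beta h -> A2_ip beta G (fun z => h (Nat.iter n phi z)) = A2_ip beta G h.
Proof.
  intros Hphi HG Hh. induction n as [|n IH]; [reflexivity|].
  rewrite <- IH. rewrite (HG (fun z => h (Nat.iter n phi z))) by now apply in_A2_iter.
  f_equal. apply functional_extensionality; intros z. now rewrite Nat.iter_succ_r.
Qed.

Lemma complex_symmetric_orbit_bounded (beta : R) (phi : C -> C) :
  -1 < beta -> self_map phi -> comp_bounded beta phi -> comp_complex_symmetric beta phi ->
  exists r, r < 1 /\ forall n, Cmod (Nat.iter n phi 0) <= r.
Proof.
  intros Hbeta [_ Hphi] [HA2 _] (J & (HJA2 & _ & _ & HJip) & Hsym).
  assert (Hw : forall n, 0 <= wt beta n <= 1).
  { intros n. assert (H := wt_bound beta n Hbeta). lra. }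
  assert (Hin0 : inD 0) by (unfold inD; rewrite Cmod_0; lra).
  (* [Cpow z 0] reduces to [1], so [one] composed with [phi] is convertible to [one], and the
     symmetry condition at [one] says that the adjoint fixes [G]. *)
  set (one := fun z : C => Cpow z 0).
  assert (Hone : in_A2 beta one) by apply in_A2_monomial.
  set (G := J one).
  assert (HG : forall g, in_A2 beta g -> A2_ip beta G g = A2_ip beta G (fun z => g (phi z)))
    by (intros g Hg; exact (Hsym one g Hone Hg)).
  destruct (HJA2 one Hone) as (g & Hg & HgS). fold G in Hg.
  assert (HGG : is_series (fun n => wt beta n * Cmod (g n) ^ 2) 1).
  { destruct HgS as [S HS]. 
    assert (HSC : Ccv (csum (fun n => (RtoC (wt beta n) * g n * Cconj (g n))%C)) (RtoC S)).
    { assert (HS0 : is_lim_seq (sum_n (fun n => wt beta n * Cmod (g n) ^ 2)) S) by exact HS.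
      assert (Hd : is_lim_seq (fun n => sum_n (fun n => wt beta n * Cmod (g n) ^ 2) n - S) (S - S))
        by (apply is_lim_seq_minus'; auto using is_lim_seq_const).
      rewrite Rminus_diag in Hd. apply is_lim_seq_abs in Hd. simpl in Hd. rewrite Rabs_R0 in Hd.
      unfold Ccv. apply is_lim_seq_incr_1.
      eapply is_lim_seq_ext; [|exact Hd]. intros n. cbv beta.
      rewrite (csum_ext _ (fun n => RtoC (wt beta n * Cmod (g n) ^ 2))), csum_RtoC.
      - now rewrite <- RtoC_minus, Cmod_R.
      - intros i _. rewrite RtoC_mult, Cmod2_conj. ring. }
    assert (H1 := A2_ip_eq beta G G g g _ Hg Hg HSC).
    assert (H2 : A2_ip beta one one = 1).
    { apply A2_ip_eq with (delta 0) (delta 0); try apply is_coef_monomial.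
      apply Ccv_ext with (fun _ => RtoC 1); [|apply Ccv_const].
      exists 1%nat; intros n Hn. rewrite (csum_delta _ O) by
        (auto; intros k Hk; unfold delta; apply Nat.eqb_neq in Hk; rewrite Hk; ring).
      apply injective_projections; simpl; ring. }
    unfold G in H1. rewrite (HJip one one Hone Hone), H2 in H1.
    apply RtoC_inj in H1. now subst S. }
  apply NNPP; intros Hno.
  assert (Hu : forall r, r < 1 -> exists n, r < Cmod (Nat.iter n phi 0)).
  { intros r Hr. apply NNPP; intros Hn. apply Hno. exists r. split; auto.
    intros n. apply Rnot_lt_le. intros H. apply Hn. now exists n. }
  assert (Hkey : forall m s, 0 < s <= 1 ->
     Rabs (wt beta m * Cmod (g m) - Cmod (g O)) <= s * (1 + Cmod (g O))).
  { intros m s Hs.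
    (* This tolerance gives [1 - |b 0|^2 <= s^2], so the error [s / 2 + (1 - |b 0|^2) / (2 s)] of
       [pairing_near_constant] is at most [s]. *)
    destruct (Cpow_near_1 _ m (s ^ 2 / 2) ltac:(nra) Hu) as [n Hn].
    set (h := fun z => Cpow (Nat.iter n phi z) m).
    assert (HhA : in_A2 beta h)
      by exact (in_A2_iter beta phi (fun z => Cpow z m) n HA2 (in_A2_monomial beta m)).
    destruct HhA as (b & Hb & HbS).
    assert (Hh1 : forall z, inD z -> Cmod (h z) <= 1).
    { intros z Hz. unfold h. rewrite Cmod_pow, <- (pow1 m). apply pow_incr.
      split; [apply Cmod_ge_0|]. apply Rlt_le, (iter_inD phi z n Hphi Hz). }
    assert (Hb0 : b O = Cpow (Nat.iter n phi 0) m) by (symmetry; exact (is_coef_at_0 b h Hb)).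
    destruct (A2_pairing_converges (wt beta) g b (fun n => proj1 (Hw n)) HgS HbS) as [v Hv].
    (* The pairing of [G] with [h] equals its pairing with [z^m], which isolates the coefficient
       [g m]. *)
    assert (Ev : v = (RtoC (wt beta m) * g m)%C).
    { rewrite <- (A2_ip_eq beta G h g b v Hg Hb Hv).
      unfold h. rewrite (fixed_functional_iter beta phi G (fun z => Cpow z m) n HA2 HG (in_A2_monomial beta m)).
      apply (A2_ip_eq beta G (fun z => Cpow z m) g (delta m)); auto using is_coef_monomial.
      apply Ccv_ext with (fun _ => (RtoC (wt beta m) * g m)%C); [|apply Ccv_const].
      exists (S m); intros k Hk. rewrite (csum_delta _ m); auto.
      - unfold delta. rewrite Nat.eqb_refl. apply injective_projections; simpl; ring.
      - intros j Hj. unfold delta. apply Nat.eqb_neq in Hj. rewrite Hj.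
        apply injective_projections; simpl; ring. }
    assert (Hb1 : Cmod (b O) <= 1) by (rewrite <- (is_coef_at_0 b h Hb); auto).
    rewrite <- Hb0 in Hn.
    assert (Hest := pairing_near_constant (wt beta) g b v s Hw eq_refl (proj1 Hs)
      (fun n => sum_n_le_series _ _ n
         (fun k => Rmult_le_pos _ _ (proj1 (Hw k)) (pow2_ge_0 _)) HGG)
      (fun n => eq_ind _ (Rle _) (coef_square_sum_bound b h 1 n Hb Hh1) _ (pow1 2)) Hv).
    assert (Hb00 := Cmod_ge_0 (b O)).
    assert (Herr : (1 - Cmod (b O) ^ 2) / (2 * s) <= s / 2).
    { apply Rle_div_l; [lra|]. nra. }
    assert (Hv1 : Cmod v = wt beta m * Cmod (g m)).
    { rewrite Ev, Cmod_mult, Cmod_R, Rabs_pos_eq; auto. apply Hw. }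
    assert (Hgb : Cmod (g O * Cconj (b O)) = Cmod (g O) * Cmod (b O))
      by now rewrite Cmod_mult, Cmod_conj.
    assert (T1 := Cmod_triangle (v - g O * Cconj (b O)) (g O * Cconj (b O))).
    replace (v - g O * Cconj (b O) + g O * Cconj (b O))%C with v in T1 by ring.
    assert (T2 := Cmod_triangle v (- (v - g O * Cconj (b O)))).
    replace (v + - (v - g O * Cconj (b O)))%C with (g O * Cconj (b O))%C in T2 by ring.
    rewrite Cmod_opp in T2. rewrite Hgb in T1, T2. rewrite Hv1 in T1, T2.
    assert (Hg0 := Cmod_ge_0 (g O)).
    assert (Hup : Cmod (g O) * Cmod (b O) <= Cmod (g O) * 1)
      by (apply Rmult_le_compat_l; lra).
    assert (Hlow : Cmod (g O) * (1 - s) <= Cmod (g O) * Cmod (b O))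
      by (apply Rmult_le_compat_l; nra).
    assert (0 <= s * Cmod (g O)) by nra.
    apply Rabs_le. split; lra. }
  assert (Heq : forall m, wt beta m * Cmod (g m) = Cmod (g O)).
  { intros m. apply Rminus_diag_uniq. apply NNPP; intros Hne.
    assert (Hpos := Rabs_pos_lt _ Hne).
    set (D := Rabs (wt beta m * Cmod (g m) - Cmod (g O))) in *.
    assert (Hg0 := Cmod_ge_0 (g O)).
    (* With this [s], [Hkey] bounds the gap [D] by [D / 2]. *)
    set (s := Rmin 1 (D / (2 * (1 + Cmod (g O))))).
    assert (Hs : 0 < s <= 1).
    { split; [|apply Rmin_l]. apply Rmin_pos; [lra|]. apply Rdiv_lt_0_compat; lra. }
    specialize (Hkey m s Hs). fold D in Hkey.
    assert (Hs2 : s <= D / (2 * (1 + Cmod (g O)))) by apply Rmin_r.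
    apply Rle_div_r in Hs2; lra. }
  assert (Hg0 : Cmod (g O) = 0).
  { assert (Hlim := ex_series_lim_0 _ HgS).
    assert (Hle : Cmod (g O) ^ 2 <= 0).
    { apply is_lim_seq_le_loc with (u := fun _ => Cmod (g O) ^ 2)
        (v := fun n => wt beta n * Cmod (g n) ^ 2)
        (l1 := Finite (Cmod (g O) ^ 2)) (l2 := Finite 0); auto using is_lim_seq_const.
      exists O; intros n _. specialize (Heq n). specialize (Hw n).
      assert (H := Cmod_ge_0 (g n)). assert (H0 := Cmod_ge_0 (g O)).
      assert (Cmod (g O) <= Cmod (g n)) by nra.
      replace (wt beta n * Cmod (g n) ^ 2) with ((wt beta n * Cmod (g n)) * Cmod (g n)) by ring.
      rewrite Heq. nra. }
    assert (H0 := Cmod_ge_0 (g O)). nra. }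
  assert (Hzero : is_series (fun n => wt beta n * Cmod (g n) ^ 2) (0 * 1)).
  { apply (is_series_ext (fun n => 0 * (wt beta n * Cmod (g n) ^ 2))).
    - intros n.
      change (0 * (wt beta n * Cmod (g n) ^ 2) = wt beta n * Cmod (g n) ^ 2).
      replace (wt beta n * Cmod (g n) ^ 2) with ((wt beta n * Cmod (g n)) * Cmod (g n)) by ring.
      rewrite Heq, Hg0. ring.
    - exact (is_series_scal_l 0 _ _ HGG). }
  apply is_series_unique in Hzero. apply is_series_unique in HGG. lra.
Qed.

Theorem theorem3p1 (beta : R) (phi : C -> C) :
  (-1 < beta)%R ->
  self_map phi ->
  comp_bounded beta phi ->
  comp_complex_symmetric beta phi ->
  (elliptic_aut phi \/
   exists omega : C, inD omega /\ iterates_converge_to phi omega) /\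
  (exists z : C, inD z /\ phi z = z).
Proof.
  intros Hbeta Hself Hbd Hcs.
  destruct (complex_symmetric_orbit_bounded beta phi Hbeta Hself Hbd Hcs) as (r & Hr & Horb).
  destruct Hself as [Hholo Hphi].
  destruct (proj1 Hbd _ (in_A2_monomial beta 1)) as (a & Ha & _).
  assert (Hcoef : is_coef a phi).
  { intros z Hz. rewrite <- (Cpow_1_r (phi z)). exact (Ha z Hz). }
  assert (HK : psd (pick_kernel 1 phi)).
  { apply pick_coef with a; auto. intros z Hz. apply Rlt_le, Hphi, Hz. }
  destruct (bounded_orbit_fixed_point phi 0 r) as (p & Hp & Hfix); auto.
  - intros x y Hx Hy. now apply schwarz_pick.
  - intros u x Hx Hu. now apply holo_Ccv.
  - unfold inD; rewrite Cmod_0; lra.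
  - split; [|now exists p].
    destruct (fixed_point_dichotomy phi p (conj Hholo Hphi) HK Hp Hfix); [now left|].
    right; now exists p.
Qed.
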